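(* Let $\alpha\in(0,\tfrac12]$, $s=p^{1-\alpha}$, and $A=\sqrt{p^{\alpha-\frac12+\delta}/n}$ where $0<\delta<\tfrac12$ and $\alpha-\tfrac12+\delta>0$. Assume either $\mathbf X\in\mathrm{SubG}(\sigma^2)$ with $n/p^2\to\infty$, or $\mathbf X\in\mathcal O_n(p)$ with $n\ge p$. Then $$\lim_{p\to\infty}\frac{\log\mathrm{Risk}(s,A)}{p^{\frac12+\delta}}=-\frac18.$$
   Context: Setting: for each $p$ one observes $(\mathbf y,\mathbf X)$ with $\mathbf y=\mathbf X\boldsymbol\beta+\boldsymbol\varepsilon$, where $\boldsymbol\varepsilon\sim\mathcal N(0,I_n)$, $\mathbf X$ is an $n\times p$ real matrix independent of $\boldsymbol\varepsilon$, $\boldsymbol\beta\in\mathbb R^p$ is unknown, and $n=n(p)\to\infty$ as $p\to\infty$. Design classes: $\mathbf X\in\mathrm{SubG}(\sigma^2)$ means the rows of $\mathbf X$ are i.i.d. centered isotropic ($\mathbb E[xx^T]=I_p$) sub-Gaussian random vectors with sub-Gaussian parameter $\sigma^2$ (for every unit $u$ and $t\in\mathbb R$, $\log\mathbb E e^{t\langle u,x\rangle}\le\sigma^2t^2/2$), and $\mathbf X^T\mathbf X$ is almost surely positive definite; $\mathbf X\in\mathcal O_n(p)$ means $\mathbf X^T\mathbf X=nI_p$. For an integer $s$ and $A>0$, $\Xi(s,A)=\{\boldsymbol\beta\in\mathbb R^p:|\mathrm{supp}(\boldsymbol\beta)|=s,\ |\beta_i|\ge A\text{ for }i\in\mathrm{supp}(\boldsymbol\beta)\}$.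 A test $T$ is a measurable $[0,1]$-valued function of $(\mathbf y,\mathbf X)$; $\mathbb P_{\boldsymbol\beta},\mathbb E_{\boldsymbol\beta}$ denote the law/expectation of $(\mathbf y,\mathbf X)$ (including the randomness of $\mathbf X$) under parameter $\boldsymbol\beta$, and $\mathbb P_0,\mathbb E_0$ those under $\boldsymbol\beta=0$. $\mathrm{Risk}(T,s,A)=\mathbb E_0[T]+\sup_{\boldsymbol\beta\in\Xi(s,A)}\mathbb E_{\boldsymbol\beta}[1-T]$ and $\mathrm{Risk}(s,A)=\inf_T\mathrm{Risk}(T,s,A)$. The sparsity is $s=p^{1-\alpha}$ (rounded to an integer) with $\alpha$ fixed; all limits are as $p\to\infty$. *)

(* Defs.v *)
From HB Require Import structures.
From mathcomp Require Import all_boot all_order all_algebra.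
From mathcomp Require Import all_classical all_reals all_analysis.
Set Implicit Arguments. Unset Strict Implicit. Unset Printing Implicit Defensive.
Import Order.TTheory GRing.Theory Num.Theory.
Local Open Scope classical_set_scope.
Local Open Scope ring_scope.

Section SparseDetection.
Context {R : realType}.

(* Encodings of data into tuples (tuples carry MathComp-Analysis' product
   (Borel) sigma-algebra, so tests can be required to be measurable). *)
Definition cv_tuple (n : nat) (v : 'cV[R]_n) : n.-tuple R :=
  [tuple v i 0 | i < n].
Definition row_tuple (n p : nat) (M : 'M[R]_(n, p)) (i : 'I_n) : p.-tuple R :=
  [tuple M i j | j < p].
Definition mx_tuple (n p : nat) (M : 'M[R]_(n, p)) : n.-tuple (p.-tuple R) :=
  [tuple row_tuple M i | i < n].

Definition obs_type (n p : nat) := (n.-tuple R * n.-tuple (p.-tuple R))%type.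

Definition is_test (n p : nat) (T : obs_type n p -> R) : Prop :=
  measurable_fun setT T /\ (forall z, 0 <= T z <= 1).

Context {d : measure_display} {Omega : measurableType d}.

(* Standing model: X is a random n x p matrix, eps a random n-vector, with
   eps ~ N(0, I_n) independent of X.  Independence and the N(0,I_n) law are
   expressed by the product rule on the generating pi-system
   {X in B} x {eps_i <= t_i for all i}. *)
Definition linear_model (n p : nat) (P : probability Omega R)
    (X : Omega -> 'M[R]_(n, p)) (eps : Omega -> 'cV[R]_n) : Prop :=
  [/\ (forall i j, measurable_fun setT (fun w => X w i j)),
      (forall i, measurable_fun setT (fun w => eps w i 0)) &
      (forall (B : set (n.-tuple (p.-tuple R))) (t : 'I_n -> R),
         measurable B ->
         P [set w | B (mx_tuple (X w)) /\ (forall i, eps w i 0 <= t i)] =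
         (fine (P [set w | B (mx_tuple (X w))]) *
          \prod_(i < n) fine (normal_prob 0 1 [set x : R | x <= t i]))%:E)].

Definition posdef (p : nat) (M : 'M[R]_p) : Prop :=
  forall v : 'cV[R]_p, v != 0 -> 0 < (v^T *m M *m v) 0 0.

Definition SubG (sigma2 : R) (n p : nat) (P : probability Omega R)
    (X : Omega -> 'M[R]_(n, p)) : Prop :=
      (forall B : 'I_n -> set (p.-tuple R), (forall i, measurable (B i)) ->
         P [set w | forall i, B i (row_tuple (X w) i)] =
         (\prod_(i < n) fine (P [set w | B i (row_tuple (X w) i)]))%:E) /\
      (forall (B : set (p.-tuple R)) i k, measurable B ->
         P [set w | B (row_tuple (X w) i)] = P [set w | B (row_tuple (X w) k)]) /\
      (forall i j, (\int[P]_w (X w i j)%:E = 0)%E) /\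
      (forall i j k, (\int[P]_w (X w i j * X w i k)%:E = (j == k)%:R%:E)%E) /\
      (forall i (u : 'cV[R]_p), \sum_(j < p) u j 0 ^+ 2 = 1 -> forall t : R,
         (\int[P]_w (expR (t * \sum_(j < p) u j 0 * X w i j))%:E
            <= (expR (sigma2 * t ^+ 2 / 2))%:E)%E) /\
      {ae P, forall w, posdef ((X w)^T *m X w)}.

Definition Orth (n p : nat) (X : Omega -> 'M[R]_(n, p)) : Prop :=
  forall w, (X w)^T *m X w = (n%:R)%:M.

Definition Xi (p : nat) (s : nat) (A : R) : set 'cV[R]_p :=
  [set b | #|[set i : 'I_p | b i 0 != 0]| = s /\
           (forall i : 'I_p, b i 0 != 0 -> A <= `|b i 0|)].




Definition Ebeta (n p : nat) (P : probability Omega R)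
    (X : Omega -> 'M[R]_(n, p)) (eps : Omega -> 'cV[R]_n)
    (T : obs_type n p -> R) (b : 'cV[R]_p) : \bar R :=
  (\int[P]_w (T (cv_tuple (X w *m b + eps w), mx_tuple (X w)))%:E)%E.

Definition RiskT (n p : nat) (P : probability Omega R)
    (X : Omega -> 'M[R]_(n, p)) (eps : Omega -> 'cV[R]_n)
    (T : obs_type n p -> R) (s : nat) (A : R) : \bar R :=
  (Ebeta P X eps T 0 +
   ereal_sup [set Ebeta P X eps (fun z => (1 - T z)%R) b | b in @Xi p s A])%E.

Definition Risk (n p : nat) (P : probability Omega R)
    (X : Omega -> 'M[R]_(n, p)) (eps : Omega -> 'cV[R]_n)
    (s : nat) (A : R) : \bar R :=
  ereal_inf [set RiskT P X eps T s A | T in @is_test n p].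

End SparseDetection.

(* Main.v *)
Require Import Defs.
From HB Require Import structures.
From mathcomp Require Import all_boot all_order all_algebra.
From mathcomp Require Import all_classical all_reals all_analysis.
From mathcomp Require Import measurable_realfun ring lra.
Import Order.TTheory GRing.Theory Num.Theory.
Local Open Scope classical_set_scope.
Local Open Scope ring_scope.

Set Implicit Arguments.
Unset Strict Implicit.
Unset Printing Implicit Defensive.

(** Put Lambda = p^(1/2+delta), which is n s A^2 up to a factor tending to 1.

    Lower bound on the risk: test 0 against one point b of Xi(s, A) all of
    whose nonzero entries equal A.  Shifting the noise to the midpoint of the
    two hypotheses, the sum of the two errors is at least
    E exp (- |Xb|^2 / 8 - |<Xb, eps>| / 2), and by Jensen this is at least
    exp (- Lambda / 8 - O(sqrt Lambda)), because E |Xb|^2 <= Lambda.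

    Upper bound: reject as soon as <Xv, y> > n s A / 2 for some vector v with
    s nonzero entries, all equal to 1 or -1.  There are at most (2p)^s such v,
    and s log p = o(Lambda) because alpha - 1/2 + delta > 0, so the union bound
    is free.  If every entry of X^T X v is within eta n of that of n v, for all
    these v, then each error is a Gaussian tail exp (- (1 - O(eta)) Lambda / 8).
    This event is certain for an orthogonal design.  For a sub-Gaussian one,
    Bernstein's inequality and another union bound show that it fails with
    probability at most p (2p)^s exp (- c eta^2 n / s), which is negligible
    since n / s >= (n / p^2) p. *)

(** * Integrals against the normal law *)

(** The constant 1/8 is (1/2)^2 / 2: the means under 0 and b are about sqrt Lambda apart and the
    threshold sits halfway, so each error behaves like a standard Gaussian tail at sqrt Lambda / 2.
    To first order, not knowing the support and the signs costs nothing.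

    The obstacle on the upper side is that entries of b have no upper bound. The noise in <Xv, y>
    has variance |Xv|^2, free of b, and the signal is <Xv, Xb> = <b, X^T X v>.

    Independence of design and noise is given on a pi-system only. It is first extended to a Tonelli
    formula that freezes X; then a single shift formula for the Gaussian vector yields the
    likelihood ratios, the exponential moments and the tails. The lower bound sees the design only
    through the mean of |Xb|^2, the upper bound only through the probability of a bad event, which
    is why both design classes share all remaining steps. *)

Section normal_facts.
Context {R : realType}.
Notation mu := (@lebesgue_measure R).

(** Change of variables is available for the abstract Radon-Nikodym derivative; this one equals
    [normal_pdf] almost everywhere because both have the same integral over every measurable set. *)
Lemma ge0_integral_normal_prob (m s : R) (f : R -> \bar R) :
  measurable_fun setT f -> (forall x, (0 <= f x)%E) ->
  (\int[normal_prob m s]_x f x = \int[mu]_x (f x * (normal_pdf m s x)%:E))%E.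
Proof.
move=> mf f0.
have dom := normal_prob_dominates m s.
rewrite -(Radon_Nikodym_SigmaFinite.change_of_variables dom)//=.
apply: ae_eq_integral => //.
- apply: emeasurable_funM => //.
  exact: measurable_int (Radon_Nikodym_SigmaFinite.f_integrable dom).
- apply: emeasurable_funM => //.
  by apply/measurable_EFinP; exact: measurable_normal_pdf.
- have : ae_eq mu setT (Radon_Nikodym_SigmaFinite.f (normal_prob m s) mu)
      (fun x => (normal_pdf m s x)%:E).
    apply: integral_ae_eq => //.
    + exact: Radon_Nikodym_SigmaFinite.f_integrable.
    + by apply/measurable_EFinP; exact: measurable_normal_pdf.
    + by move=> E _ mE; rewrite -Radon_Nikodym_SigmaFinite.f_integral.
  by apply: filterS => x /= + _ => ->.
Qed.

Lemma lebesgue_measure_shift (a : R) (A : set R) : measurable A ->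
  pushforward mu (fun x : R => (x + a : measurableTypeR R)) A = mu A.
Proof.
move=> mA.
have ms : measurable_fun [set: R] (fun x : R => (x + a : measurableTypeR R)).
  exact: measurable_funD.
pose f : {mfun R >-> measurableTypeR R} := 
  HB.pack (fun x : R => (x + a : measurableTypeR R)) (isMeasurableFun.Build _ _ _ _ _ ms).
rewrite -[LHS]/(pushforward mu f A).
apply/esym/lebesgue_measure_unique => //= _ [[u v]] _ <-.
rewrite /pushforward (_ : f @^-1` _ = `]u - a, v - a]%classic); last first.
  by apply/seteqP; split => x/=; rewrite /f/= !in_itv/= ltrBlDr lerBrDr.
rewrite !lebesgue_measure_itv/= !lte_fin ltrD2r.
by case: ifPn => // _; rewrite -!EFinB; congr EFin; ring.
Qed.

Lemma ge0_integral_lebesgue_shift (a : R) (f : R -> \bar R) :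
  measurable_fun setT f -> (forall x, (0 <= f x)%E) ->
  (\int[mu]_x f (x + a)%R = \int[mu]_x f x)%E.
Proof.
move=> mf f0.
have ms : measurable_fun [set: measurableTypeR R]
    (fun x : measurableTypeR R => (x + a : measurableTypeR R)).
  exact: measurable_funD.
pose g : {mfun measurableTypeR R >-> measurableTypeR R} :=
  HB.pack (fun x : measurableTypeR R => (x + a : measurableTypeR R))
    (isMeasurableFun.Build _ _ _ _ _ ms).
transitivity (\int[pushforward mu g]_x f x)%E.
  by rewrite ge0_integral_pushforward.
by apply: eq_measure_integral => A mA _; exact: lebesgue_measure_shift.
Qed.

Lemma normal_pdf1E (x : R) :
  normal_pdf 0 1 x = normal_peak 1 * expR (- (x ^+ 2) / 2).
Proof.
by rewrite normal_pdfE ?oner_eq0// /normal_fun subr0 expr1n mulr2n.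
Qed.

(** One-dimensional Cameron-Martin formula: translate the Lebesgue integral and complete the square,
    -(x - a)^2 / 2 = - x^2 / 2 + (a x - a^2 / 2). *)
Lemma ge0_integral_normal_shift (a : R) (h : R -> \bar R) :
  measurable_fun setT h -> (forall x, (0 <= h x)%E) ->
  (\int[normal_prob 0 1]_x h (x + a)%R =
   \int[normal_prob 0 1]_x (h x * (expR (a * x - a ^+ 2 / 2))%:E))%E.
Proof.
move=> mh h0.
have mpdf : measurable_fun setT (fun x : R => (normal_pdf 0 1 x)%:E).
  by apply/measurable_EFinP; exact: measurable_normal_pdf.
have msh (b : R) : measurable_fun setT (fun x : R => x + b).
  exact: measurable_funD.
have mexp : measurable_fun setT (fun x : R => expR (a * x - a ^+ 2 / 2)).
  apply: measurableT_comp => //; apply: measurable_funB => //.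
rewrite !ge0_integral_normal_prob//.
- rewrite -[RHS](ge0_integral_lebesgue_shift a).
  + apply: eq_integral => x _; rewrite -muleA; congr (_ * _)%E.
    rewrite -EFinM; congr EFin; rewrite !normal_pdf1E mulrCA; congr *%R.
    by rewrite -expRD; congr expR; field.
  + apply: emeasurable_funM => //; apply: emeasurable_funM => //.
    exact/measurable_EFinP.
  + move=> x; rewrite !mule_ge0// ?lee_fin ?expR_ge0//.
    exact: normal_pdf_ge0.
- by apply: emeasurable_funM => //; exact/measurable_EFinP.
- by move=> x; rewrite mule_ge0// lee_fin expR_ge0.
- exact: measurableT_comp.
Qed.

(** The shift formula for the constant function 1 says that exp (t x - t^2 / 2) has mean 1. *)
Lemma normal_prob_mgf (t : R) :
  (\int[normal_prob 0 1]_x (expR (t * x))%:E = (expR (t ^+ 2 / 2))%:E)%E.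
Proof.
have := @ge0_integral_normal_shift t (cst 1%E) (measurable_cst _) (fun _ => lee01).
rewrite integral_cst//= mul1e probability_setT.
under eq_integral do rewrite mul1e expRD EFinM.
have me : measurable_fun setT (fun x : R => (expR (t * x))%:E).
  apply/measurable_EFinP; exact: measurableT_comp.
rewrite ge0_integralZr//.
move=> /(congr1 (fun z => z * (expR (t ^+ 2 / 2))%:E)%E).
by rewrite mul1e -muleA -EFinM -expRD addNr expR0 mule1 => ->.
Qed.

(** Multiplying the density by exp (x^2 / 4) leaves exp (- x^2 / 4), which is sqrt 2 times the
    density of variance 2 after normalisation. *)
Lemma normal_prob_exp_sqr :
  (\int[normal_prob 0 1]_x (expR (x ^+ 2 / 4))%:E = (Num.sqrt (2 : R))%:E)%E.
Proof.
have s0 : Num.sqrt (2 : R) != 0 by rewrite gt_eqF// sqrtr_gt0.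
rewrite ge0_integral_normal_prob; last 2 first.
- apply/measurable_EFinP; apply: measurableT_comp => //.
  by apply: measurable_funM => //; exact: measurable_funX.
- by move=> x; rewrite lee_fin expR_ge0.
transitivity (\int[mu]_x ((Num.sqrt (2 : R))%:E *
    (normal_pdf 0 (Num.sqrt 2) x)%:E))%E; last first.
  rewrite ge0_integralZl//.
  - by rewrite integral_normal_pdf mule1.
  - by apply/measurable_EFinP; exact: measurable_normal_pdf.
  - by move=> x _; rewrite lee_fin normal_pdf_ge0.
apply: eq_integral => x _; rewrite -!EFinM; congr EFin.
rewrite normal_pdf1E normal_pdfE// /normal_fun subr0 sqr_sqrtr//.
have pk : normal_peak 1 = Num.sqrt 2 * normal_peak (Num.sqrt (2:R)).
  rewrite /normal_peak sqr_sqrtr// expr1n mul1r -[2 * pi *+ 2]mulrnAr.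
  by rewrite sqrtrM// invfM mulVKf.
rewrite [in RHS]mulrA -pk mulrCA -expRD; congr (_ * expR _).
rewrite -mulr_natr; lra.
Qed.

End normal_facts.

(** * Product measures on tuples *)

Section tuple_boxes.
Context {d : measure_display} {T : measurableType d} (n : nat).

Definition box (B : 'I_n -> set T) : set (n.-tuple T) :=
  [set x | forall i, B i (tnth x i)].

Lemma measurable_box (B : 'I_n -> set T) :
  (forall i, measurable (B i)) -> measurable (box B).
Proof.
move=> mB.
rewrite (_ : box B = \bigcap_(i in [set: 'I_n]) ((@tnth n T)^~ i @^-1` B i)).
  apply: fin_bigcap_measurable => // i _.
  by rewrite -[X in measurable X]setTI; exact: measurable_tnth.
by apply/seteqP; split => x /= Bx i; [move=> _|]; exact: Bx.
Qed.

Variables (G : set (set T)) (g : (set T)^nat).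
Hypotheses (mG : measurable = <<s G >>) (GI : setI_closed G).
Hypothesis Gg : forall k, G (g k).
Hypothesis ndg : nondecreasing_seq g.
Hypothesis gT : \bigcup_k g k = setT.

(** The whole space need not lie in [G] (it is not a half-line), so a cylinder over one coordinate
    is not itself a box. It is the union over k of the boxes with [g k] at every other coordinate;
    since [g] increases, the maximum of finitely many indices serves all coordinates at once. *)
Lemma box_generates :
  @measurable _ (n.-tuple T) =
  <<s [set box B | B in [set B | forall i, G (B i)] ] >>.
Proof.
have Gm A : G A -> measurable A by rewrite mG; exact: sub_sigma_algebra.
apply/seteqP; split.
- apply: smallest_sub; first exact: smallest_sigma_algebra.
  rewrite -bigcup_seq => _ [i _] [B mB <-].
  rewrite setTI.
  set S := <<s _ >>.
  pose F := [set B : set T | S ((@tnth n T)^~ i @^-1` B)].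
  suff : <<s G >> `<=` F by apply; rewrite -mG.
  apply: smallest_sub.
    split.
    + by rewrite /F /= preimage_set0; exact: sigma_algebra0.
    + move=> A FA; rewrite /F /= setTD -preimage_setC -setTD.
      exact: sigma_algebraCD.
    + move=> A FA; rewrite /F /= preimage_bigcup.
      exact: sigma_algebra_bigcup.
  move=> A GA; rewrite /F /=.
  pose C k (j : 'I_n) := if j == i then A else g k.
  rewrite (_ : _ @^-1` A = \bigcup_k box (C k)).
    apply: sigma_algebra_bigcup => k; apply: sub_sigma_algebra.
    by exists (C k) => // j; rewrite /C; case: ifPn.
  apply/seteqP; split => [x /= Ax|x [k _] /(_ i)]; last by rewrite /C eqxx.
  have gx j : exists k, g k (tnth x j).
    have : setT (tnth x j) by [].
    by rewrite -gT => -[k _ ?]; exists k.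
  have [K gK] := choice gx.
  exists (\max_(j < n) K j)%N => // j; rewrite /C; case: eqP => [->//|_].
  have /ndg/subsetPset : (K j <= \max_(j < n) K j)%N by exact: leq_bigmax.
  by apply.
- apply: smallest_sub; first exact: sigma_algebra_measurable.
  by move=> _ [B GB <-]; apply: measurable_box => i; exact/Gm/GB.
Qed.

(** Serves twice: with half-lines for the law of the noise, and with all measurable sets for the law
    of the rows of the design. *)
Lemma tuple_measure_unique {R : realType}
    (m1 m2 : {measure set (n.-tuple T) -> \bar R}) :
  (forall B : 'I_n -> set T, (forall i, G (B i)) -> m1 (box B) = m2 (box B)) ->
  (m1 setT < +oo)%E ->
  forall A, measurable A -> m1 A = m2 A.
Proof.
move=> m12 m1oo A mA.
have Gm B : G B -> measurable B by rewrite mG; exact: sub_sigma_algebra.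
apply: (measure_unique [set box B | B in [set B | forall i, G (B i)] ]
  (fun k => box (fun=> g k))) => //.
- exact: box_generates.
- move=> _ _ [B GB <-] [C GC <-]; exists (fun i => B i `&` C i).
    by move=> i; apply: GI.
  by apply/seteqP; split => x /= => [BC|[xB xC] i]; [split => i; have [] := BC i|split].
- by move=> k; exists (fun=> g k).
- apply/seteqP; split => // x _.
  have gx j : exists k, g k (tnth x j).
    have : setT (tnth x j) by [].
    by rewrite -gT => -[k _ ?]; exists k.
  have [K gK] := choice gx.
  exists (\max_(j < n) K j)%N => // j.
  have /ndg/subsetPset : (K j <= \max_(j < n) K j)%N by exact: leq_bigmax.
  by apply.
- by move=> _ [B GB <-]; exact: m12.
- move=> k; apply: le_lt_trans m1oo; apply: le_measure => //; rewrite inE//.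
  by apply: measurable_box => i; exact: Gm.
Qed.

End tuple_boxes.

Section iid.
Context {d : measure_display} {T : measurableType d} {R : realType}.
Variable nu : probability T R.

Definition pair_tuple n (z : T * n.-tuple T) : n.+1.-tuple T :=
  [tuple of z.1 :: z.2].

Lemma measurable_pair_tuple n : measurable_fun setT (@pair_tuple n).
Proof. exact: measurable_cons. Qed.

HB.instance Definition _ n :=
  isMeasurableFun.Build _ _ _ _ (@pair_tuple n) (@measurable_pair_tuple n).

(** Building the n-fold product by recursion, as the image of a binary product under cons, lets
    Tonelli peel off one coordinate at a time. *)
Fixpoint iid_prob n : probability (n.-tuple T) R :=
  if n is m.+1 then distribution (nu \x iid_prob m)%E (@pair_tuple m)
  else dirac [tuple].

Lemma ge0_integral_iidS n (f : n.+1.-tuple T -> \bar R) :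
  measurable_fun setT f -> (forall x, (0 <= f x)%E) ->
  (\int[iid_prob n.+1]_x f x =
   \int[nu]_x \int[iid_prob n]_y f (pair_tuple (x, y)))%E.
Proof.
move=> mf f0.
have mfc : measurable_fun setT (f \o @pair_tuple n).
  by apply: measurableT_comp => //; exact: measurable_pair_tuple.
by rewrite ge0_integral_distribution//= fubini_tonelli1.
Qed.

Lemma ge0_integral_iid0 (f : 0.-tuple T -> \bar R) :
  measurable_fun setT f -> 
  (\int[iid_prob 0]_x f x = f [tuple])%E.
Proof. by move=> mf; rewrite integral_dirac// diracT mul1e. Qed.

Lemma ge0_integral_iid_prod n (f : 'I_n -> T -> R) :
  (forall i, measurable_fun setT (f i)) -> (forall i x, 0 <= f i x) ->
  (\int[iid_prob n]_x (\prod_(i < n) f i (tnth x i))%:E =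
   \prod_(i < n) \int[nu]_x (f i x)%:E)%E.
Proof.
elim: n f => [|n IH] f mf f0.
  rewrite ge0_integral_iid0 ?big_ord0//.
  by under eq_fun do rewrite big_ord0; exact: measurable_cst.
have mp m (h : 'I_m -> T -> R) : (forall i, measurable_fun setT (h i)) ->
    measurable_fun setT (fun x : m.-tuple T => (\prod_(i < m) h i (tnth x i))%:E).
  move=> mh; apply/measurable_EFinP; apply: measurable_prod => i _.
  by apply: measurableT_comp => //; exact: measurable_tnth.
rewrite ge0_integral_iidS//; last 2 first.
- exact: mp.
- by move=> x; rewrite lee_fin prodr_ge0.
rewrite big_ord_recl -IH//.
rewrite -ge0_integralZr//; last 3 first.
- exact/measurable_EFinP.
- by move=> x _; rewrite lee_fin.
- by apply: integral_ge0 => x _; rewrite lee_fin prodr_ge0.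
apply: eq_integral => x _; rewrite -ge0_integralZl//; last 3 first.
- by apply: (mp _ (fun i => f (lift ord0 i))).
- by move=> y _; rewrite lee_fin prodr_ge0.
- by rewrite lee_fin.
apply: eq_integral => y _; rewrite -EFinM; congr EFin.
rewrite big_ord_recl; congr (_ * _).
by apply: eq_bigr => i _; rewrite tnthS.
Qed.

Lemma iid_prob_box n (B : 'I_n -> set T) : (forall i, measurable (B i)) ->
  iid_prob n (box B) = (\prod_(i < n) nu (B i))%E.
Proof.
move=> mB.
transitivity (\int[iid_prob n]_x (\1_(box B) x)%:E)%E.
  by rewrite integral_indic ?setIT//; exact: measurable_box.
transitivity (\prod_(i < n) \int[nu]_x (\1_(B i) x)%:E)%E; last first.
  by apply: eq_bigr => i _; rewrite integral_indic ?setIT.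
rewrite -(@ge0_integral_iid_prod n (fun i => \1_(B i)))//.
apply: eq_integral => x _; congr EFin.
rewrite indicE; case: (boolP (x \in box B)) => [|/negP] xB.
  by rewrite big1// => i _; rewrite indicE; move: xB; rewrite !inE => /(_ i) /mem_set ->.
have [i Bi] : exists i, ~ B i (tnth x i).
  by apply/existsNP => Bx; apply: xB; rewrite inE.
by rewrite (bigD1 i)//= indicE memNset// mul0r.
Qed.

End iid.

Section gaussian_tuple.
Context {R : realType}.

Let idR : measurableTypeR R -> R := idfun.

Let measurable_idR : measurable_fun setT idR.
Proof. by move=> _ B mB; rewrite setTI. Qed.

#[local] HB.instance Definition _ :=
  isMeasurableFun.Build _ _ _ _ idR measurable_idR.

(* [normal_prob] lives on [measurableTypeR R], the tuples of the model on
   [R] with its own measurable structure; the identity transports it. *)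
Definition std_normal : probability R R := distribution (normal_prob 0 1) idR.

Lemma ge0_integral_std_normal (f : R -> \bar R) :
  measurable_fun setT f -> (forall x, (0 <= f x)%E) ->
  (\int[std_normal]_x f x = \int[normal_prob 0 1]_x f x)%E.
Proof. by move=> mf f0; rewrite ge0_integral_distribution. Qed.

Lemma ge0_integral_std_normal_shift (a : R) (h : R -> \bar R) :
  measurable_fun setT h -> (forall x, (0 <= h x)%E) ->
  (\int[std_normal]_x h (x + a)%R =
   \int[std_normal]_x (h x * (expR (a * x - a ^+ 2 / 2))%:E))%E.
Proof.
move=> mh h0; rewrite !ge0_integral_std_normal//.
- exact: ge0_integral_normal_shift.
- apply: emeasurable_funM => //; apply/measurable_EFinP.
  by apply: measurableT_comp => //; exact: measurable_funB.
- by move=> x; rewrite mule_ge0// lee_fin expR_ge0.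
- by apply: measurableT_comp => //; exact: measurable_funD.
Qed.

Definition gauss_prob (n : nat) : probability (n.-tuple R) R :=
  iid_prob std_normal n.

Definition shift_tuple n (a : 'I_n -> R) (x : n.-tuple R) : n.-tuple R :=
  [tuple tnth x i + a i | i < n].

Lemma measurable_shift_tuple n (a : 'I_n -> R) :
  measurable_fun setT (shift_tuple a).
Proof.
apply/measurable_fun_tnthP => i.
rewrite (_ : _ \o _ = fun x => tnth x i + a i).
  by apply: measurable_funD => //; exact: measurable_tnth.
by apply/funext => x /=; rewrite tnth_mktuple.
Qed.

(** Logarithm of the density of N(a, I_n) with respect to N(0, I_n). *)
Definition gauss_lik n (a : 'I_n -> R) (x : n.-tuple R) : R :=
  \sum_(i < n) (a i * tnth x i - a i ^+ 2 / 2).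

Lemma measurable_gauss_lik n (a : 'I_n -> R) :
  measurable_fun setT (gauss_lik a).
Proof.
apply: measurable_sum => i; apply: measurable_funB => //.
by apply: measurable_funM => //; exact: measurable_tnth.
Qed.

(** Cameron-Martin in dimension n, by induction: the tail is shifted inside the inner integral, and
    the one-dimensional formula is then applied to the function of the head that this integral
    defines. *)
Lemma ge0_integral_gauss_shift n (a : 'I_n -> R) (h : n.-tuple R -> \bar R) :
  measurable_fun setT h -> (forall x, (0 <= h x)%E) ->
  (\int[gauss_prob n]_x h (shift_tuple a x) =
   \int[gauss_prob n]_x (h x * (expR (gauss_lik a x))%:E))%E.
Proof.
have mexp m (c : 'I_m -> R) :
    measurable_fun setT (fun x : m.-tuple R => (expR (gauss_lik c x))%:E).
  apply/measurable_EFinP; apply: measurableT_comp => //.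
  exact: measurable_gauss_lik.
have mshift m (c : 'I_m -> R) (k : m.-tuple R -> \bar R) :
    measurable_fun setT k -> measurable_fun setT (fun x => k (shift_tuple c x)).
  by move=> mk; apply: measurableT_comp => //; exact: measurable_shift_tuple.
have mlik m (c : 'I_m -> R) (k : m.-tuple R -> \bar R) :
    measurable_fun setT k ->
    measurable_fun setT (fun x => k x * (expR (gauss_lik c x))%:E)%E.
  by move=> mk; apply: emeasurable_funM => //; exact: mexp.
elim: n a h => [|n IH] a h mh h0.
  rewrite (ge0_integral_iid0 _ (mshift _ a _ mh)).
  rewrite (ge0_integral_iid0 _ (mlik _ a _ mh)).
  by rewrite /gauss_lik big_ord0 expR0 mule1 [shift_tuple _ _]tuple0.
rewrite (ge0_integral_iidS _ (mshift _ a _ mh))//.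
rewrite (ge0_integral_iidS _ (mlik _ a _ mh)); last first.
  by move=> x; rewrite mule_ge0// lee_fin expR_ge0.
pose a' i := a (lift ord0 i).
have shE x y : shift_tuple a (pair_tuple (x, y)) =
    pair_tuple (x + a ord0, shift_tuple a' y).
  apply: eq_from_tnth => i; rewrite tnth_mktuple.
  case: (unliftP ord0 i) => [j|] ->; last by [].
  by rewrite !tnthS tnth_mktuple.
have likE x y : gauss_lik a (pair_tuple (x, y)) =
    (a ord0 * x - a ord0 ^+ 2 / 2) + gauss_lik a' y.
  rewrite /gauss_lik big_ord_recl; congr (_ + _).
  by apply: eq_bigr => i _; rewrite tnthS.
have mhc : measurable_fun setT (h \o @pair_tuple _ R n).
  by apply: measurableT_comp => //; exact: measurable_pair_tuple.
have mF : measurable_fun setT (fun z : R * n.-tuple R =>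
    h (pair_tuple z) * (expR (gauss_lik a' z.2))%:E)%E.
  by apply: emeasurable_funM => //; apply: (measurableT_comp (mexp _ a')).
have F0 z : (0 <= h (pair_tuple z) * (expR (gauss_lik a' z.2))%:E)%E.
  by rewrite mule_ge0// lee_fin expR_ge0.
under eq_integral => x _.
  under eq_integral do rewrite shE.
  rewrite (IH a' (fun y => h (pair_tuple (x + a ord0, y))))//; last first.
    exact: (measurableT_comp mhc).
  over.
have mF1 : measurable_fun setT (fun x =>
    \int[gauss_prob n]_y (h (pair_tuple (x, y)) * (expR (gauss_lik a' y))%:E))%E.
  exact: (measurable_fun_fubini_tonelli_F (fun z => h (pair_tuple z) * (expR (gauss_lik a' z.2))%:E)%E).
have F10 x : (0 <= \int[gauss_prob n]_y (h (pair_tuple (x, y)) * (expR (gauss_lik a' y))%:E))%E.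
  by apply: integral_ge0 => y _; exact: (F0 (x, y)).
rewrite (ge0_integral_std_normal_shift _ mF1 F10).
apply: eq_integral => x _; rewrite -ge0_integralZr//.
  apply: eq_integral => y _; rewrite -muleA -EFinM -expRD.
  by rewrite likE addrC.
exact: (measurableT_comp mF).
Qed.

End gaussian_tuple.

(** * Joint law of the design and the noise *)

Section half_lines.
Context {R : realType}.

(** The pi-system on which [linear_model] specifies the law of each noise coordinate. *)
Definition half_lines : set (set R) := range (fun t : R => [set x : R | x <= t]).

Lemma half_line_itv (t : R) : [set x : R | x <= t] = `]-oo, t]%classic.
Proof. by apply/seteqP; split => x /=; rewrite in_itv. Qed.

Lemma half_lines_generate : @measurable _ R = <<s half_lines >>.
Proof.
apply/seteqP; split.
- suff : <<s @RGenOInfty.G R >> `<=` <<s half_lines >>.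
    by apply: subset_trans; rewrite -[X in _ `<=` X]RGenOInfty.measurableE.
  apply: smallest_sub.
    exact: smallest_sigma_algebra.
  move=> _ [x ->]; rewrite -setCitvl -setTD -half_line_itv.
  by apply: sigma_algebraCD; apply: sub_sigma_algebra; exists x.
- apply: smallest_sub; first exact: sigma_algebra_measurable.
  by move=> _ [t _ <-]; rewrite half_line_itv; exact: measurable_itv.
Qed.

Lemma half_lines_setI : setI_closed half_lines.
Proof.
move=> _ _ [s _ <-] [t _ <-]; exists (Num.min s t) => //.
by apply/seteqP; split => x /=; rewrite le_min => /andP.
Qed.

Lemma half_lines_cover : \bigcup_k [set x : R | x <= k%:R] = setT.
Proof.
apply/seteqP; split => // x _; exists (Num.truncn `|x|).+1 => //=.
by apply/ltW/(le_lt_trans (ler_norm x)); rewrite truncnS_gt.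
Qed.

Lemma half_lines_nd : nondecreasing_seq (fun k => [set x : R | x <= k%:R]).
Proof.
move=> m k mk; apply/subsetPset => x /= /le_trans; apply.
by rewrite ler_nat.
Qed.

End half_lines.

Section joint_law.
Context {R : realType} {d : measure_display} {Omega : measurableType d}.
Variables (n p : nat) (P : probability Omega R).
Variables (X : Omega -> 'M[R]_(n, p)) (eps : Omega -> 'cV[R]_n).
Hypothesis model : linear_model P X eps.

Definition Xtuple w := mx_tuple (X w).
Definition Etuple w := cv_tuple (eps w).

Lemma measurable_Xtuple : measurable_fun setT Xtuple.
Proof.
have [mX _ _] := model.
apply/measurable_fun_tnthP => i; apply/measurable_fun_tnthP => j.
apply: eq_measurable_fun (mX i j) => w _ /=.
by rewrite !tnth_mktuple.
Qed.

Lemma measurable_Etuple : measurable_fun setT Etuple.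
Proof.
have [_ mE _] := model.
apply/measurable_fun_tnthP => i.
apply: eq_measurable_fun (mE i) => w _ /=.
by rewrite !tnth_mktuple.
Qed.

Let XT : {mfun Omega >-> n.-tuple (p.-tuple R)} :=
  HB.pack Xtuple (isMeasurableFun.Build _ _ _ _ Xtuple measurable_Xtuple).

Let ET : {mfun Omega >-> n.-tuple R} :=
  HB.pack Etuple (isMeasurableFun.Build _ _ _ _ Etuple measurable_Etuple).

(** For fixed [B] both sides are finite measures in [C], and the model says that they agree on boxes
    of half-lines. *)
Lemma model_independent (B : set (n.-tuple (p.-tuple R))) (C : set (n.-tuple R)) :
  measurable B -> measurable C ->
  (P (Xtuple @^-1` B `&` Etuple @^-1` C) =
   P (Xtuple @^-1` B) * gauss_prob n C)%E.
Proof.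
move=> mB mC.
have mXB : measurable (Xtuple @^-1` B).
  by rewrite -[X in measurable X]setTI; exact: measurable_Xtuple.
have fPB : P (Xtuple @^-1` B) \is a fin_num by exact: fin_num_measure.
have r0 : 0 <= fine (P (Xtuple @^-1` B)) by rewrite fine_ge0.
(* Both measures stay unnormalised, so there is no division by P(X in B), which may vanish. *)
pose m1 := pushforward (mrestr P mXB) ET.
pose m2 := mscale (NngNum r0) (gauss_prob n).
transitivity (m1 C); first by rewrite /m1 /pushforward /mrestr setIC.
transitivity (m2 C); last by rewrite /m2 /mscale/= fineK.
apply: (tuple_measure_unique half_lines_generate half_lines_setI
  _ half_lines_nd half_lines_cover) => //.
- by move=> k; exists k%:R.
- move=> D GD.
  have [t tE] : exists t : 'I_n -> R, forall i, D i = [set x | x <= t i].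
    have /choice[t tE] : forall i, exists t, D i = [set x | x <= t].
      by move=> i; have [t _ <-] := GD i; exists t.
    by exists t.
  have [_ _ ind] := model.
  change (P (Etuple @^-1` box D `&` Xtuple @^-1` B) =
    (fine (P (Xtuple @^-1` B)))%:E * iid_prob std_normal n (box D))%E.
  rewrite iid_prob_box; last first.
    by move=> i; rewrite half_lines_generate; exact: sub_sigma_algebra.
  transitivity ((fine (P (Xtuple @^-1` B)) *
     \prod_(i < n) fine (normal_prob 0 1 [set x : R | x <= t i]))%:E).
    rewrite -ind//; congr (P _); apply/seteqP; split => w /=.
      move=> [Dw Bw]; split => // i; move: (Dw i).
      by rewrite tE /= tnth_mktuple.
    move=> [Bw Dw]; split => // i; rewrite tE /= tnth_mktuple; exact: Dw.
  rewrite EFinM; congr (_ * _)%E; rewrite -prodEFin.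
  apply: eq_bigr => i _; rewrite tE fineK//.
  apply: fin_num_measure; rewrite half_line_itv; exact: measurable_itv.
- change (P (Etuple @^-1` setT `&` Xtuple @^-1` B) < +oo)%E.
  by rewrite preimage_setT setTI ltey_eq fPB.
Qed.

(** This replaces conditioning on X: with the design frozen in the outer integral, the noise is
    still standard Gaussian in the inner one. *)
Lemma ge0_integral_model (f : n.-tuple (p.-tuple R) * n.-tuple R -> \bar R) :
  measurable_fun setT f -> (forall z, (0 <= f z)%E) ->
  (\int[P]_w f (Xtuple w, Etuple w) =
   \int[distribution P XT]_x \int[gauss_prob n]_e f (x, e))%E.
Proof.
move=> mf f0.
have mXE : measurable_fun setT (fun w => (Xtuple w, Etuple w)).
  by apply: measurable_fun_pair;
    [exact: measurable_Xtuple|exact: measurable_Etuple].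
pose XE : {mfun Omega >-> (n.-tuple (p.-tuple R) * n.-tuple R)%type} :=
  HB.pack (fun w => (Xtuple w, Etuple w)) (isMeasurableFun.Build _ _ _ _ _ mXE).
rewrite -(fubini_tonelli1 f)//.
transitivity (\int[distribution P XE]_z f z)%E.
  by rewrite ge0_integral_distribution.
apply: eq_measure_integral => A mA _; apply/esym.
apply: (@product_measure_unique _ _ _ _ _ _ _ (distribution P XE)) => // B C mB mC.
by rewrite -model_independent.
Qed.

End joint_law.

Lemma le_integral_EFin {d : measure_display} {T : measurableType d}
    {R : realType} (mu : {measure set T -> \bar R}) (f g : T -> R) :
  measurable_fun setT f -> measurable_fun setT g ->
  (forall x, 0 <= f x) -> (forall x, f x <= g x) ->
  (\int[mu]_x (f x)%:E <= \int[mu]_x (g x)%:E)%E.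
Proof.
move=> mf mg f0 fg; apply: ge0_le_integral => //.
- by move=> x _; rewrite lee_fin.
- exact/measurable_EFinP.
- exact/measurable_EFinP.
- by move=> x _; rewrite lee_fin.
Qed.

Lemma ge0_integralD_fin {d : measure_display} {T : measurableType d}
    {R : realType} (mu : {measure set T -> \bar R}) (f g : T -> R) :
  measurable_fun setT f -> measurable_fun setT g ->
  (forall x, 0 <= f x) -> (forall x, 0 <= g x) ->
  (\int[mu]_x (f x + g x)%:E = \int[mu]_x (f x)%:E + \int[mu]_x (g x)%:E)%E.
Proof.
move=> mf mg f0 g0; under eq_integral do rewrite EFinD.
apply: ge0_integralD => //; try exact/measurable_EFinP.
- by move=> x _; rewrite lee_fin.
- by move=> x _; rewrite lee_fin.
Qed.

Lemma ge0_integralZl_fin {d : measure_display} {T : measurableType d}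
    {R : realType} (mu : {measure set T -> \bar R}) (k : R) (f : T -> R) :
  0 <= k -> measurable_fun setT f -> (forall x, 0 <= f x) ->
  (\int[mu]_x (k * f x)%:E = k%:E * \int[mu]_x (f x)%:E)%E.
Proof.
move=> k0 mf f0; under eq_integral do rewrite EFinM.
apply: ge0_integralZl => //; first exact/measurable_EFinP.
by move=> x _; rewrite lee_fin.
Qed.

Lemma integral_cst_probability {d : measure_display} {T : measurableType d}
    {R : realType} (P : probability T R) (c : \bar R) : (\int[P]_x c = c)%E.
Proof. by rewrite integral_cst//= probability_setT mule1. Qed.

(** * Noise shifts that depend on the design, and Gaussian tails given the design *)

Section model_noise.
Context {R : realType} {d : measure_display} {Omega : measurableType d}.
Variables (n p : nat) (P : probability Omega R).
Variables (X : Omega -> 'M[R]_(n, p)) (eps : Omega -> 'cV[R]_n).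
Hypothesis model : linear_model P X eps.

Local Notation XT := (Xtuple X).
Local Notation ET := (Etuple eps).
Local Notation design := (n.-tuple (p.-tuple R)).

Lemma measurable_design_noise d' (T : measurableType d')
    (f : design * n.-tuple R -> T) :
  measurable_fun setT f -> measurable_fun setT (fun w => f (XT w, ET w)).
Proof.
move=> mf; apply: (measurableT_comp mf); apply: measurable_fun_pair.
- exact: measurable_Xtuple model.
- exact: measurable_Etuple model.
Qed.

Section shift.
Variable a : design -> 'I_n -> R.
Hypothesis ma : forall i, measurable_fun setT (a ^~ i).

Let ma1 i : measurable_fun setT (fun z : design * n.-tuple R => a z.1 i).
Proof. exact: (measurableT_comp (ma i)). Qed.

Let mt2 (i : 'I_n) : measurable_fun setT (fun z : design * n.-tuple R => tnth z.2 i).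
Proof. exact: (measurableT_comp (measurable_tnth i)). Qed.

Lemma measurable_joint_shift :
  measurable_fun setT (fun z : design * n.-tuple R => (z.1, shift_tuple (a z.1) z.2)).
Proof.
apply: measurable_fun_pair => //; apply/measurable_fun_tnthP => i.
have := measurable_funD (mt2 i) (ma1 i).
by apply: eq_measurable_fun => z _ /=; rewrite tnth_mktuple.
Qed.

Lemma measurable_joint_lik :
  measurable_fun setT (fun z : design * n.-tuple R => gauss_lik (a z.1) z.2).
Proof.
apply: measurable_sum => i; apply: measurable_funB.
- exact: measurable_funM.
- by apply: measurable_funM => //; exact: measurable_funX.
Qed.

(** The shift may depend on the design, because it is a constant vector once the design is
    frozen. *)
Lemma noise_shift (h : design * n.-tuple R -> \bar R) :
  measurable_fun setT h -> (forall z, (0 <= h z)%E) ->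
  (\int[P]_w h (XT w, shift_tuple (a (XT w)) (ET w)) =
   \int[P]_w (h (XT w, ET w) *
     (expR (gauss_lik (a (XT w)) (ET w)))%:E))%E.
Proof.
move=> mh h0.
pose h1 z := h (z.1, shift_tuple (a z.1) z.2).
pose h2 z := (h z * (expR (gauss_lik (a z.1) z.2))%:E)%E.
have mh1 : measurable_fun setT h1 by exact: (measurableT_comp mh measurable_joint_shift).
have mh2 : measurable_fun setT h2.
  apply: emeasurable_funM => //; apply/measurable_EFinP.
  by apply: measurableT_comp => //; exact: measurable_joint_lik.
have h20 z : (0 <= h2 z)%E by rewrite mule_ge0// lee_fin expR_ge0.
rewrite -[LHS]/(\int[P]_w h1 (XT w, ET w))%E.
rewrite -[RHS]/(\int[P]_w h2 (XT w, ET w))%E.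
rewrite !(ge0_integral_model model)//; last by move=> z; exact: h0.
apply: eq_integral => x _; rewrite /h1 /h2 /=.
apply: (ge0_integral_gauss_shift (a x) (h := fun e => h (x, e))) => //.
exact: (measurableT_comp mh).
Qed.

(** The shift formula for a function [h] of the design alone, which the shift leaves unchanged. The
    factor exp (|a|^2 / 2) placed in [h] cancels the quadratic part of the likelihood. *)
Lemma noise_mgf (g : design -> R) :
  measurable_fun setT g -> (forall x, 0 <= g x) ->
  (\int[P]_w (g (XT w) * expR (\sum_(i < n) a (XT w) i * eps w i 0))%:E =
   \int[P]_w (g (XT w) * expR (\sum_(i < n) a (XT w) i ^+ 2 / 2))%:E)%E.
Proof.
move=> mg g0.
pose h (z : design * n.-tuple R) := (g z.1 * expR (\sum_(i < n) a z.1 i ^+ 2 / 2))%:E.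
transitivity (\int[P]_w h (XT w, shift_tuple (a (XT w)) (ET w)))%E; last by [].
rewrite noise_shift.
- apply: eq_integral => w _; rewrite /h -EFinM -mulrA -expRD; congr (_ * expR _)%:E.
  rewrite /gauss_lik -big_split/=; apply: eq_bigr => i _.
  by rewrite tnth_mktuple; ring.
- apply/measurable_EFinP; apply: measurable_funM.
    exact: (measurableT_comp mg).
  apply: measurableT_comp => //; apply: measurable_sum => i.
  by apply: measurable_funM => //; exact: measurable_funX.
- by move=> z; rewrite lee_fin mulr_ge0// expR_ge0.
Qed.

End shift.

Section direction.
Variable b : 'cV[R]_p.

(** Together with [energy] and [noise_form] below this stands for Xb, |Xb|^2 and <Xb, eps>. The
    first two are functions of the encoded design, as the shift lemmas require. *)
Definition predictor (x : design) (i : 'I_n) : R :=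
  \sum_(j < p) tnth (tnth x i) j * b j 0.

Lemma measurable_predictor i : measurable_fun setT (predictor ^~ i).
Proof.
apply: measurable_sum => j; apply: measurable_funM => //.
apply: (@measurableT_comp _ _ _ _ _ _ (fun t : p.-tuple R => tnth t j)).
  exact: measurable_tnth.
exact: measurable_tnth.
Qed.

Lemma predictorE w i : predictor (XT w) i = (X w *m b) i 0.
Proof.
by rewrite mxE; apply: eq_bigr => j _; rewrite !tnth_mktuple.
Qed.

Definition energy (x : design) : R := \sum_(i < n) predictor x i ^+ 2.

Lemma measurable_energy : measurable_fun setT energy.
Proof.
apply: measurable_sum => i; apply: measurable_funX; exact: measurable_predictor.
Qed.

Lemma energy_ge0 x : 0 <= energy x.
Proof. by apply: sumr_ge0 => i _; rewrite sqr_ge0. Qed.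

Lemma energyE w : energy (XT w) = \sum_(i < n) (X w *m b) i 0 ^+ 2.
Proof. by apply: eq_bigr => i _; rewrite predictorE. Qed.

Definition noise_form w : R := \sum_(i < n) (X w *m b) i 0 * eps w i 0.

Lemma measurable_noise_form : measurable_fun setT noise_form.
Proof.
apply: measurable_sum => i; apply: measurable_funM; last by have [_ + _] := model.
apply: eq_measurable_fun (measurableT_comp (measurable_predictor i) (measurable_Xtuple model)).
by move=> w _; rewrite /= predictorE.
Qed.

(** Chernoff's bound given X, where <Xb, eps> is N(0, |Xb|^2). The cap on the variance concerns the
    design only, so its indicator can be part of the weight [g] in [noise_mgf]. *)
Lemma noise_form_tail (C tau : R) : 0 < C -> 0 <= tau ->
  (P [set w | (energy (XT w) <= C)%R /\ (tau <= noise_form w)%R] <=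
   (expR (- (tau ^+ 2 / (2 * C))))%:E)%E.
Proof.
move=> C0 tau0.
(* The minimiser of - t tau + t^2 C / 2. *)
pose t := tau / C.
have t0 : 0 <= t by rewrite divr_ge0// ltW.
pose G := [set x : design | energy x <= C].
have mG : measurable G.
  rewrite -[G]setTI; apply: measurable_fun_le => //; exact: measurable_energy.
pose g x : R := expR (- (t * tau)) * \1_G x.
have mg : measurable_fun setT g by exact: measurable_funM.
have g0 x : 0 <= g x by rewrite mulr_ge0// expR_ge0.
set S := [set w | _].
have mS : measurable S.
  rewrite (_ : S = (XT @^-1` G) `&` [set w | tau <= noise_form w])//.
  apply: measurableI.
    by rewrite -[X in measurable X]setTI; exact: (measurable_Xtuple model).
  by rewrite -[X in measurable X]setTI; apply: measurable_fun_le => //; exact: measurable_noise_form.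
have ma i : measurable_fun setT (fun x => t * predictor x i).
  by apply: measurable_funM => //; exact: measurable_predictor.
have mXg (f : design -> R) : measurable_fun setT f -> measurable_fun setT (fun w => f (XT w)).
  by move=> mf; apply: (measurableT_comp mf); exact: (measurable_Xtuple model).
rewrite -[S]setIT -integral_indic//.
apply: (@le_trans _ _ (\int[P]_w (g (XT w) *
    expR (\sum_(i < n) (t * predictor (XT w) i) * eps w i 0))%:E)%E).
  apply: le_integral_EFin => //.
    apply: measurable_funM; first exact: mXg.
    apply: measurableT_comp => //; apply: measurable_sum => i.
    by apply: measurable_funM; [exact: (mXg _ (ma i))|have [_ + _] := model].
  move=> w; rewrite indicE.
  case: (boolP (w \in S)) => [|_]; last by rewrite mulr_ge0// expR_ge0.
  rewrite inE => -[Gw tw]; rewrite /g indicE mem_set// mulr1 -expRD.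
  rewrite -[leLHS]expR0 ler_expR.
  have -> : \sum_(i < n) t * predictor (XT w) i * eps w i 0 = t * noise_form w.
    by rewrite mulr_sumr; apply: eq_bigr => i _; rewrite predictorE mulrA.
  by rewrite addrC subr_ge0 ler_wpM2l.
rewrite (noise_mgf (a := fun x i => t * predictor x i))//.
apply: (@le_trans _ _ (\int[P]_w (expR (- (tau ^+ 2 / (2 * C))))%:E)%E); last first.
  by rewrite integral_cst//= probability_setT mule1.
apply: le_integral_EFin => //.
- apply: measurable_funM; first exact: mXg.
  apply: measurableT_comp => //; apply: measurable_sum => i.
  by apply: measurable_funM => //; apply: measurable_funX; exact: (mXg _ (ma i)).
- by move=> w; rewrite mulr_ge0// expR_ge0.
- move=> w; rewrite /g indicE.
  case: (boolP (_ \in _)) => [|_]; last by rewrite mulr0 mul0r expR_ge0.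
  rewrite inE => Gw; rewrite mulr1 -expRD ler_expR.
  have -> : \sum_(i < n) (t * predictor (XT w) i) ^+ 2 / 2 = t ^+ 2 / 2 * energy (XT w).
    by rewrite mulr_sumr; apply: eq_bigr => i _; rewrite exprMn mulrAC.
  apply: (@le_trans _ _ (- (t * tau) + t ^+ 2 / 2 * C)).
    by rewrite lerD2l ler_wpM2l// divr_ge0// sqr_ge0.
  by rewrite /t le_eqVlt; apply/orP; left; apply/eqP; field; rewrite gt_eqF.
Qed.

End direction.

End model_noise.

(** * Lower bound on the risk *)

Section lower_bound.
Context {R : realType} {d : measure_display} {Omega : measurableType d}.
Variables (n p : nat) (P : probability Omega R).
Variables (X : Omega -> 'M[R]_(n, p)) (eps : Omega -> 'cV[R]_n).
Hypothesis model : linear_model P X eps.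

Local Notation XT := (Xtuple X).
Local Notation ET := (Etuple eps).
Local Notation design := (n.-tuple (p.-tuple R)).

Lemma Ebeta0E (T : obs_type n p -> R) :
  Ebeta P X eps T 0 = (\int[P]_w (T (ET w, XT w))%:E)%E.
Proof. by apply: eq_integral => w _; rewrite mulmx0 add0r. Qed.

Lemma EbetaE (T : obs_type n p -> R) (b : 'cV[R]_p) :
  Ebeta P X eps T b =
  (\int[P]_w (T (shift_tuple (predictor b (XT w)) (ET w), XT w))%:E)%E.
Proof.
apply: eq_integral => w _; congr (T (_, _))%:E.
apply: eq_from_tnth => i.
by rewrite !tnth_mktuple mxE predictorE addrC.
Qed.

Lemma gauss_lik_half (b : 'cV[R]_p) (c : R) w :
  gauss_lik (fun i => c * predictor b (XT w) i) (ET w) =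
  c * noise_form X eps b w - c ^+ 2 / 2 * energy b (XT w).
Proof.
rewrite /gauss_lik /energy /noise_form !mulr_sumr -sumrB.
by apply: eq_bigr => i _; rewrite tnth_mktuple predictorE; ring.
Qed.

(* Both errors are rewritten as expectations under the noise shifted to the
   midpoint between the two hypotheses, where the smaller of the two
   likelihood weights is the integrand below. *)
Lemma error_sum_ge (T : obs_type n p -> R) (b : 'cV[R]_p) : is_test T ->
  (\int[P]_w (expR (- (energy b (XT w) / 8 + `|noise_form X eps b w| / 2)))%:E <=
   Ebeta P X eps T 0 + Ebeta P X eps (fun z => (1 - T z)%R) b)%E.
Proof.
move=> [mT T01].
have T0 z : 0 <= T z by case/andP: (T01 z).
have T1 z : 0 <= 1 - T z by rewrite subr_ge0; case/andP: (T01 z).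
pose a (c : R) (x : design) i := c * predictor b x i.
have ma c i : measurable_fun setT (a c ^~ i).
  by apply: measurable_funM => //; exact: measurable_predictor.
pose mid (z : design * n.-tuple R) : obs_type n p :=
  (shift_tuple (a 2^-1 z.1) z.2, z.1).
have mmid : measurable_fun setT mid.
  apply: measurable_fun_pair => //.
  exact: (measurableT_comp measurable_snd (measurable_joint_shift (ma 2^-1))).
pose h0 z := (T (mid z))%:E; pose h1 z := (1 - T (mid z))%:E.
have mh0 : measurable_fun setT h0 by apply/measurable_EFinP; exact: measurableT_comp.
have mh1 : measurable_fun setT h1.
  by apply/measurable_EFinP; apply: measurable_funB => //; exact: measurableT_comp.
rewrite Ebeta0E EbetaE.
have -> : (\int[P]_w (T (ET w, XT w))%:E =
    \int[P]_w h0 (XT w, shift_tuple (a (- 2^-1)%R (XT w)) (ET w)))%E.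
  apply: eq_integral => w _; rewrite /h0 /mid/=; congr (T (_, _))%:E.
  apply: eq_from_tnth => i; rewrite !tnth_mktuple /a; ring.
have -> : (\int[P]_w (1 - T (shift_tuple (predictor b (XT w)) (ET w), XT w))%R%:E =
    \int[P]_w h1 (XT w, shift_tuple (a 2^-1%R (XT w)) (ET w)))%E.
  apply: eq_integral => w _; rewrite /h1 /mid/=; congr (1 - T (_, _))%:E.
  by apply: eq_from_tnth => i; rewrite !tnth_mktuple /a; field.
rewrite !(noise_shift model (a := a _)) //; last 2 first.
- by move=> z; rewrite lee_fin.
- by move=> z; rewrite lee_fin.
have mW := measurable_noise_form model b.
have mQ : measurable_fun setT (fun w => energy b (XT w)).
  exact: (measurableT_comp (measurable_energy b) (measurable_Xtuple model)).
have mexp c : measurable_fun setT (fun w => (expR (gauss_lik (a c (XT w)) (ET w)))%:E).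
  apply/measurable_EFinP; apply: measurableT_comp => //.
  exact: (measurable_design_noise model (measurable_joint_lik (ma c))).
have mhw (h : design * n.-tuple R -> \bar R) : measurable_fun setT h ->
    measurable_fun setT (fun w => h (XT w, ET w)).
  exact: (measurable_design_noise model).
rewrite -ge0_integralD//; last 4 first.
- by move=> w _; rewrite mule_ge0// lee_fin ?expR_ge0.
- by apply: emeasurable_funM => //; exact: mhw.
- by move=> w _; rewrite mule_ge0// lee_fin ?expR_ge0.
- by apply: emeasurable_funM => //; exact: mhw.
apply: ge0_le_integral => //.
- apply/measurable_EFinP; apply: measurableT_comp => //.
  apply: measurable_funN; apply: measurable_funD; apply: measurable_funM => //.
  exact: measurableT_comp.
- by apply: emeasurable_funD; apply: emeasurable_funM => //; exact: mhw.
move=> w _; rewrite /h0 /h1 -!EFinM -EFinD lee_fin.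
rewrite !gauss_lik_half.
set t := T _; have t0 : 0 <= t by exact: T0.
have t1 : 0 <= 1 - t by exact: T1.
set W := noise_form X eps b w; set Q := energy b _.
set E := expR (- _).
(* Shifting by -1/2 and 1/2 times Xb gives the weights exp (- W / 2 - Q / 8) and exp (W / 2 - Q /
   8); both are at least [E]. *)
have -> : E = t * E + (1 - t) * E by ring.
apply: lerD; rewrite ler_wpM2l// ler_expR.
- have := ler_norm W; lra.
- have := ler_norm (- W); rewrite normrN; lra.
Qed.

(** Write <Xb, eps> as |Xb| times its component along a unit vector and use |s| <= exp s + exp (-
    s). Each exponential moment is at most exp (1/2) <= 2, so only [noise_mgf] is needed. *)
Lemma integral_noise_form_le (b : 'cV[R]_p) (l : R) : 0 < l ->
  (\int[P]_w (energy b (XT w))%:E <= l%:E)%E ->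
  (\int[P]_w `|noise_form X eps b w|%:E <= (4 * Num.sqrt l)%:E)%E.
Proof.
move=> l0 Ql.
have mQX : measurable_fun setT (fun w => energy b (XT w)).
  exact: (measurableT_comp (measurable_energy b) (measurable_Xtuple model)).
have QX0 w : 0 <= energy b (XT w) by exact: energy_ge0.
pose Q (x : design) := energy b x.
pose r : design -> R := fun x => Num.sqrt (Q x).
(* The unit vector Xb / |Xb| times a sign c. It is zero where Xb is, which is why [a1] below is only
   an inequality. *)
pose a (c : R) (x : design) i := c * (predictor b x i * Q x `^ (- 2^-1)).
have mQ : measurable_fun setT Q by exact: measurable_energy.
have Q0 x : 0 <= Q x by exact: energy_ge0.
have rE x : r x = Q x `^ 2^-1 by rewrite powR12_sqrt.
have mr : measurable_fun setT r.
  rewrite (_ : r = (fun y => y `^ 2^-1) \o Q); last exact/funext.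
  by apply: measurableT_comp => //; exact: measurable_powR.
have ma c i : measurable_fun setT (a c ^~ i).
  apply: measurable_funM => //; apply: measurable_funM.
    exact: measurable_predictor.
  exact: (measurableT_comp (@measurable_powR R (- 2^-1)) mQ).
have r0 x : 0 <= r x by exact: sqrtr_ge0.
have rK x : Q x != 0 -> r x * Q x `^ (- 2^-1) = 1.
  by move=> Qx; rewrite rE -powRD ?subrr ?powRr0// Qx implybT.
have a1 c x : c ^+ 2 = 1 -> \sum_(i < n) a c x i ^+ 2 / 2 <= 2^-1.
  move=> c1; have -> : \sum_(i < n) a c x i ^+ 2 / 2 = (Q x `^ (- 2^-1)) ^+ 2 / 2 * Q x.
    rewrite [in RHS]/Q /energy mulr_sumr; apply: eq_bigr => i _.
    by rewrite /a !exprMn c1; ring.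
  have [->|Qx] := eqVneq (Q x) 0; first by rewrite mulr0 invr_ge0.
  have -> : (Q x `^ (- 2^-1)) ^+ 2 / 2 * Q x = (r x * Q x `^ (- 2^-1)) ^+ 2 / 2.
    by rewrite exprMn sqr_sqrtr//; ring.
  by rewrite rK// expr1n mul1r.
have WE w : noise_form X eps b w =
    r (XT w) * \sum_(i < n) a 1 (XT w) i * eps w i 0.
  have [Qx|Qx] := eqVneq (Q (XT w)) 0.
    rewrite /r Qx sqrtr0 mul0r; apply: big1 => i _.
    move: Qx; rewrite /Q /energy => /eqP; rewrite psumr_eq0; last first.
      by move=> j _; exact: sqr_ge0.
    by move=> /allP /(_ i (mem_index_enum _))/=; rewrite sqrf_eq0 predictorE => /eqP ->; rewrite mul0r.
  rewrite mulr_sumr; apply: eq_bigr => i _.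
  transitivity ((r (XT w) * Q (XT w) `^ (- 2^-1)) * ((X w *m b) i 0 * eps w i 0)).
    by rewrite rK// mul1r.
  by rewrite /a predictorE; ring.
have aN x i : a (-1) x i = - a 1 x i by rewrite /a; ring.
have mlin c : measurable_fun setT (fun w => \sum_(i < n) a c (XT w) i * eps w i 0).
  apply: measurable_sum => i; apply: measurable_funM; last by have [_ + _] := model.
  exact: (measurableT_comp (ma c i) (measurable_Xtuple model)).
have mrX : measurable_fun setT (fun w => r (XT w)).
  exact: (measurableT_comp mr (measurable_Xtuple model)).
pose F c w := r (XT w) * expR (\sum_(i < n) a c (XT w) i * eps w i 0).
have mF c : measurable_fun setT (F c).
  by apply: measurable_funM => //; exact: measurableT_comp.
have F0 c w : 0 <= F c w by rewrite mulr_ge0// expR_ge0.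
have mrl : measurable_fun setT (fun w => energy b (XT w) / Num.sqrt l).
  exact: measurable_funM.
have sl : 0 < Num.sqrt l by rewrite sqrtr_gt0.
have sl2 : Num.sqrt l * Num.sqrt l = l by rewrite -expr2 sqr_sqrtr// ltW.
have Fle c : c ^+ 2 = 1 -> (\int[P]_w (F c w)%:E <= (2 * Num.sqrt l)%:E)%E.
  move=> c1; rewrite (noise_mgf model (ma c) mr r0).
  apply: (@le_trans _ _ (\int[P]_w (energy b (XT w) / Num.sqrt l + Num.sqrt l)%:E)%E).
    apply: le_integral_EFin => //.
    - apply: measurable_funM => //; apply: measurableT_comp => //.
      apply: measurable_sum => i; apply: measurable_funM => //; apply: measurable_funX.
      exact: (measurableT_comp (ma c i) (measurable_Xtuple model)).
    - exact: measurable_funD.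
    - by move=> w; rewrite mulr_ge0// expR_ge0.
    (* After exp (1/2) <= 2, the bound 2 r <= r^2 / sqrt l + sqrt l brings in r^2, whose mean is
       known to be at most l. *)
    move=> w; apply: (@le_trans _ _ (r (XT w) * 2)).
      rewrite ler_wpM2l//; apply: (@le_trans _ _ (expR 2^-1)).
        by rewrite ler_expR a1.
      have := expR_ge1Dx (- 2^-1 : R); rewrite expRN => h.
      rewrite -lef_pV2 ?posrE ?expR_gt0//.
      by apply: le_trans h; lra.
    have -> : energy b (XT w) = r (XT w) ^+ 2 by rewrite sqr_sqrtr.
    have -> : r (XT w) ^+ 2 / Num.sqrt l + Num.sqrt l =
        (r (XT w) ^+ 2 + Num.sqrt l * Num.sqrt l) / Num.sqrt l.
      by field; rewrite gt_eqF.
    rewrite ler_pdivlMr//.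
    have := sqr_ge0 (r (XT w) - Num.sqrt l); nra.
  have mrl0 w : 0 <= energy b (XT w) / Num.sqrt l by rewrite divr_ge0// ltW.
  have sl0 (_ : Omega) : 0 <= Num.sqrt l by exact: ltW.
  rewrite (ge0_integralD_fin (g := fun=> Num.sqrt l) _ mrl (measurable_cst _) mrl0 sl0).
  rewrite integral_cst_probability.
  under eq_integral do rewrite mulrC.
  have sV0 : 0 <= (Num.sqrt l)^-1 by rewrite invr_ge0 ltW.
  rewrite ge0_integralZl_fin//.
  apply: (@le_trans _ _ ((Num.sqrt l)^-1%:E * l%:E + (Num.sqrt l)%:E)%E).
    by rewrite leeD2r// lee_wpmul2l// lee_fin.
  by rewrite -EFinM -EFinD lee_fin -{2}sl2 mulKf ?gt_eqF// mulr_natl mulr2n.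
apply: (@le_trans _ _ (\int[P]_w (F 1 w + F (-1) w)%:E)%E).
  apply: le_integral_EFin => //.
  - apply: measurableT_comp => //; exact: (measurable_noise_form model).
  - exact: measurable_funD.
  move=> w; rewrite WE normrM ger0_norm// /F -mulrDr ler_wpM2l//.
  have -> : \sum_(i < n) a (-1) (XT w) i * eps w i 0 =
      - \sum_(i < n) a 1 (XT w) i * eps w i 0.
    by rewrite -sumrN; apply: eq_bigr => i _; rewrite aN mulNr.
  set s := \sum_(i < n) _.
  have h1 := expR_ge1Dx s; have h2 := expR_ge1Dx (- s).
  have h3 := expR_ge0 s; have h4 := expR_ge0 (- s).
  by rewrite ler_norml; apply/andP; split; lra.
rewrite ge0_integralD_fin//.
apply: (@le_trans _ _ ((2 * Num.sqrt l)%:E + (2 * Num.sqrt l)%:E)%E).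
  by apply: leeD; apply: Fle; rewrite ?sqrrN expr1n.
by rewrite -EFinD lee_fin; lra.
Qed.

(** Jensen's inequality for exp, with [m] an upper bound for the mean of [F]; 2 sqrt l is half of
    the bound on E |<Xb, eps>|. *)
Lemma integral_overlap_ge (b : 'cV[R]_p) (l : R) : 0 < l ->
  (\int[P]_w (energy b (XT w))%:E <= l%:E)%E ->
  ((expR (- (l / 8 + 2 * Num.sqrt l)))%:E <=
   \int[P]_w (expR (- (energy b (XT w) / 8 + `|noise_form X eps b w| / 2)))%:E)%E.
Proof.
move=> l0 Ql.
have mQX : measurable_fun setT (fun w => energy b (XT w)).
  exact: (measurableT_comp (measurable_energy b) (measurable_Xtuple model)).
have QX0 w : 0 <= energy b (XT w) by exact: energy_ge0.
have Wl := integral_noise_form_le l0 Ql.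
set m := l / 8 + _.
pose F w := energy b (XT w) / 8 + `|noise_form X eps b w| / 2.
have mQ : measurable_fun setT (fun w => energy b (XT w) / 8).
  exact: measurable_funM.
have mN : measurable_fun setT (fun w => `|noise_form X eps b w|).
  by apply: measurableT_comp => //; exact: (measurable_noise_form model).
have mW : measurable_fun setT (fun w => `|noise_form X eps b w| / 2).
  exact: measurable_funM.
have mF : measurable_fun setT F by exact: measurable_funD.
have F0 w : 0 <= F w by rewrite addr_ge0// divr_ge0// energy_ge0.
have meF : measurable_fun setT (fun w => expR (- F w)).
  by apply: measurableT_comp => //; exact: measurable_funN.
have IF : (\int[P]_w (F w)%:E <= m%:E)%E.
  have e0 w : 0 <= energy b (XT w) / 8 by rewrite divr_ge0.
  have n0 w : 0 <= `|noise_form X eps b w| / 2 by rewrite divr_ge0.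
  rewrite ge0_integralD_fin//.
  rewrite EFinD; apply: leeD.
  - under eq_integral do rewrite mulrC.
    rewrite ge0_integralZl_fin//.
    by rewrite [l / 8]mulrC EFinM lee_wpmul2l// lee_fin.
  - under eq_integral do rewrite mulrC.
    rewrite ge0_integralZl_fin//.
    have -> : (2 * Num.sqrt l)%:E = ((2^-1)%:E * (4 * Num.sqrt l)%:E :> \bar R)%E.
      by rewrite -EFinM; congr EFin; lra.
    by rewrite lee_wpmul2l// lee_fin.
have em0 : 0 <= expR (- m) by exact: expR_ge0.
(* the tangent line of exp at - m, in a form where both sides are nonnegative *)
have tangent : ((expR (- m) * (1 + m))%:E <=
    \int[P]_w (expR (- F w))%:E + (expR (- m))%:E * \int[P]_w (F w)%:E)%E.
  have mmF : measurable_fun setT (fun w => expR (- m) * F w) by exact: measurable_funM.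
  have mF0 w : 0 <= expR (- m) * F w by rewrite mulr_ge0.
  rewrite -ge0_integralZl_fin// -ge0_integralD_fin//.
  have m0 : 0 <= m by rewrite addr_ge0// ?divr_ge0// ?mulr_ge0 ?sqrtr_ge0// ltW.
  apply: (@le_trans _ _ (\int[P]_w (expR (- m) * (1 + m))%:E)%E).
    by rewrite integral_cst_probability.
  apply: (@le_integral_EFin _ _ _ P (fun=> expR (- m) * (1 + m)) (fun w => expR (- F w) + expR (- m) * F w)) => //.
  - by apply: measurable_funD => //; exact: measurable_funM.
  - by move=> w; rewrite mulr_ge0// addr_ge0.
  move=> w; have -> : - F w = - m + (m - F w) by ring.
  rewrite expRD -mulrDr ler_wpM2l//.
  have := expR_ge1Dx (m - F w); lra.
have fI : (\int[P]_w (F w)%:E \is a fin_num)%E.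
  rewrite ge0_fin_numE; first exact: le_lt_trans IF (ltry _).
  by apply: integral_ge0 => w _; rewrite lee_fin.
have : ((expR (- m) * (1 + m))%:E <=
    \int[P]_w (expR (- F w))%:E + (expR (- m) * m)%:E)%E.
  by apply: (le_trans tangent); rewrite leeD2l// EFinM lee_wpmul2l// lee_fin.
by rewrite -leeBlDr// -EFinB mulrDr mulr1 addrK.
Qed.

Lemma Risk_ge (s : nat) (A : R) (b : 'cV[R]_p) (l : R) : 0 < l ->
  Xi s A b -> (\int[P]_w (energy b (XT w))%:E <= l%:E)%E ->
  ((expR (- (l / 8 + 2 * Num.sqrt l)))%:E <= Risk P X eps s A)%E.
Proof.
move=> l0 Xib Ql; apply: le_ereal_inf_tmp => _ [T tT <-].
apply: (le_trans (integral_overlap_ge l0 Ql)).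
apply: (le_trans (error_sum_ge b tT)).
by rewrite leeD2l//; apply: ereal_sup_ubound; exists b.
Qed.

End lower_bound.

(** * Upper bound on the risk *)

Lemma measurable_bigsetU_fin {d : measure_display} {T : measurableType d}
    (I : finType) (S : I -> set T) :
  (forall i, measurable (S i)) -> measurable (\big[setU/set0]_(i : I) S i).
Proof. by move=> mS; apply: bigsetU_measurable => i _; exact: mS. Qed.

Lemma measure_bigsetU_fin_le {d : measure_display} {T : measurableType d}
    {R : realType} (P : {measure set T -> \bar R}) (I : finType)
    (S : I -> set T) (e : R) :
  (forall i, measurable (S i)) -> (forall i, (P (S i) <= e%:E)%E) ->
  (P (\big[setU/set0]_(i : I) S i) <= (#|I|%:R * e)%:E)%E.
Proof.
move=> mS Se.
suff : forall r : seq I, (P (\big[setU/set0]_(i <- r) S i) <= ((size r)%:R * e)%:E)%E.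
  by move=> /(_ (index_enum I)); rewrite cardE /index_enum -enumT.
elim=> [|i r IH]; first by rewrite big_nil measure0 mul0r.
rewrite big_cons (le_trans (measureU2 _ _ _))//.
  by apply: bigsetU_measurable => j _; exact: mS.
by rewrite /= -add1n natrD mulrDl mul1r EFinD leeD.
Qed.

Lemma measurable_fun_lt {d : measure_display} {T : measurableType d}
    {R : realType} (f g : T -> R) :
  measurable_fun setT f -> measurable_fun setT g ->
  measurable [set x | f x < g x].
Proof.
move=> mf mg; rewrite -[X in measurable X]setTI.
under eq_set => x do rewrite -lte_fin.
by apply: measurable_lte => //; exact: measurableT_comp.
Qed.

Section upper_bound.
Context {R : realType} {d : measure_display} {Omega : measurableType d}.
Variables (n p : nat) (P : probability Omega R).
Variables (X : Omega -> 'M[R]_(n, p)) (eps : Omega -> 'cV[R]_n).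
Hypothesis model : linear_model P X eps.

Local Notation XT := (Xtuple X).
Local Notation ET := (Etuple eps).
Local Notation design := (n.-tuple (p.-tuple R)).

(** Entry j of X^T X v, written as a sum over the rows, which are independent in the sub-Gaussian
    case. *)
Definition gram_col (v : 'cV[R]_p) (j : 'I_p) (w : Omega) : R :=
  \sum_(i < n) X w i j * (X w *m v) i 0.

Lemma measurable_gram_col v j : measurable_fun setT (gram_col v j).
Proof.
have [mX _ _] := model.
apply: measurable_sum => i; apply: measurable_funM => //.
have := measurableT_comp (measurable_predictor v i) (measurable_Xtuple model).
by apply: eq_measurable_fun => w _ /=; rewrite predictorE.
Qed.

Lemma gram_colE (v b : 'cV[R]_p) w :
  \sum_(i < n) (X w *m v) i 0 * (X w *m b) i 0 = \sum_(j < p) b j 0 * gram_col v j w.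
Proof.
under [RHS]eq_bigr do rewrite /gram_col mulr_sumr.
rewrite exchange_big/=; apply: eq_bigr => i _.
rewrite [X in _ * X]mxE mulr_sumr; apply: eq_bigr => j _; ring.
Qed.

Variables (s : nat) (A eta : R).
Hypotheses (n0 : 0 < n%:R :> R) (s0 : 0 < s%:R :> R) (A0 : 0 <= A).
Hypotheses (eta0 : 0 <= eta) (eta2 : eta <= 2^-1).

Variables (I : finType) (v : I -> 'cV[R]_p).
(* that is, every entry is -1, 0 or 1 *)
Hypothesis v_sign : forall f j, v f j 0 ^+ 2 = `|v f j 0|.
Hypothesis v_size : forall f, \sum_(j < p) `|v f j 0| = s%:R.
(** Some [v f] carries the signs of b on its support; the sizes of the entries are irrelevant, so a
    finite family covers the infinite set [Xi s A]. *)
Hypothesis v_cover : forall b, Xi s A b ->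
  exists f, forall j, b j 0 * v f j 0 = `|b j 0|.

Definition bad : set Omega := \big[setU/set0]_(fj : I * 'I_p)
  [set w | eta * n%:R < `|gram_col (v fj.1) fj.2 w - n%:R * v fj.1 fj.2 0|].

Lemma measurable_bad : measurable bad.
Proof.
apply: measurable_bigsetU_fin => -[f j] /=.
apply: measurable_fun_lt => //.
apply: measurableT_comp => //; apply: measurable_funB => //.
exact: measurable_gram_col.
Qed.

Lemma not_bad w : ~ bad w -> forall f j,
  `|gram_col (v f) j w - n%:R * v f j 0| <= eta * n%:R.
Proof.
move=> Bw f j; rewrite leNgt; apply/negP => h; apply: Bw.
by rewrite /bad -bigcup_seq; exists (f, j) => //=; rewrite mem_index_enum.
Qed.

(** Off the bad event [C] bounds the noise variance of a statistic. The threshold [tau] is half the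
    nominal signal n s A, and [tau'] is what the guaranteed signal n s A (1 - eta) leaves above it;
    [test_exponent] is tau'^2 / (2 C). *)
Let C : R := n%:R * s%:R * (1 + eta).
Let tau : R := n%:R * s%:R * A / 2.
Let tau' : R := n%:R * s%:R * A * (2^-1 - eta).
Definition test_exponent : R := n%:R * s%:R * A ^+ 2 * (1 - 2 * eta) ^+ 2 / (8 * (1 + eta)).

Let ns0 : 0 < n%:R * s%:R :> R.
Proof. exact: mulr_gt0. Qed.

Let C0 : 0 < C.
Proof. by apply: mulr_gt0; [exact: ns0 | have := eta0; lra]. Qed.

(** In |Xv|^2 = <v, X^T X v>, replacing X^T X v by n v costs at most eta n |v|_1 = eta n s. *)
Lemma energy_good w f : ~ bad w -> energy (v f) (XT w) <= C.
Proof.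
move=> /not_bad /(_ f) good.
have e0 := eta0; have eh := eta2; have n00 := n0; have s00 := s0.
rewrite energyE; under eq_bigr do rewrite expr2.
rewrite gram_colE /C -(v_size f) mulrAC mulrC mulr_suml.
apply: ler_sum => j _.
have := good j; set g := gram_col _ _ _; set c := v f j 0.
have cc : c ^+ 2 = `|c| by exact: v_sign.
move=> h; have : c * (g - n%:R * c) <= `|c| * (eta * n%:R).
  by apply: le_trans (ler_norm _) _; rewrite normrM ler_wpM2l.
have -> : c * (g - n%:R * c) = c * g - n%:R * c ^+ 2 by ring.
rewrite cc; nra.
Qed.

(** As <b, v> = |b|_1, the inner product <b, X^T X v> is at least n (1 - eta) |b|_1, and |b|_1 >= s
    A. *)
Lemma signal_good w f b : ~ bad w -> Xi s A b ->
  (forall j, b j 0 * v f j 0 = `|b j 0|) ->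
  n%:R * s%:R * A * (1 - eta) <=
  \sum_(i < n) (X w *m v f) i 0 * (X w *m b) i 0.
Proof.
move=> /not_bad /(_ f) good [bs bA] bv.
have e0 := eta0; have eh := eta2; have n00 := n0; have s00 := s0.
rewrite gram_colE.
apply: (@le_trans _ _ (\sum_(j < p) `|b j 0| * (n%:R * (1 - eta)))); last first.
  apply: ler_sum => j _; have := good j; set g := gram_col _ _ _ => h.
  have : `|b j 0 * (g - n%:R * v f j 0)| <= `|b j 0| * (eta * n%:R).
    by rewrite normrM ler_wpM2l.
  rewrite ler_norml => /andP[+ _].
  have -> : b j 0 * (g - n%:R * v f j 0) = b j 0 * g - n%:R * (b j 0 * v f j 0) by ring.
  rewrite bv; nra.
rewrite -mulr_suml.
have sA : s%:R * A <= \sum_(j < p) `|b j 0|.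
  rewrite -bs -sum1_card natr_sum mulr_suml [leRHS](bigID (mem [set i : 'I_p | b i 0 != 0]))/=.
  rewrite -[leLHS]addr0; apply: lerD; last exact: sumr_ge0.
  by apply: ler_sum => j; rewrite mul1r inE => /bA.
have -> : n%:R * s%:R * A * (1 - eta) = s%:R * A * (n%:R * (1 - eta)) by ring.
by rewrite ler_wpM2r// mulr_ge0//; lra.
Qed.

Let T (z : obs_type n p) : R := \1_(\big[setU/set0]_(f : I)
  [set z : obs_type n p | tau < \sum_(i < n) predictor (v f) z.2 i * tnth z.1 i]) z.

Let score f w b := \sum_(i < n) (X w *m v f) i 0 * (X w *m b + eps w) i 0.

Let mD : measurable (\big[setU/set0]_(f : I)
  [set z : obs_type n p | tau < \sum_(i < n) predictor (v f) z.2 i * tnth z.1 i]).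
Proof.
apply: measurable_bigsetU_fin => f.
apply: measurable_fun_lt => //.
apply: measurable_sum => i; apply: measurable_funM.
  exact: (measurableT_comp (measurable_predictor (v f) i) measurable_snd).
exact: (measurableT_comp (measurable_tnth i) measurable_fst).
Qed.

Let T_test : is_test T.
Proof.
split; first exact: measurable_indic.
by move=> z; rewrite /T indicE; case: (_ \in _); rewrite /= ?lexx ?ler01.
Qed.

Let TE b w : T (cv_tuple (X w *m b + eps w), mx_tuple (X w)) =
  \1_(\big[setU/set0]_(f : I) [set w | tau < score f w b]) w.
Proof.
rewrite /T !indicE; congr (nat_of_bool _)%:R; apply/idP/idP; rewrite !inE -!bigcup_seq.
- move=> [f fI /= h]; exists f => //=; move: h; congr (_ < _).
  by apply: eq_bigr => i _; rewrite predictorE tnth_mktuple.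
- move=> [f fI /= h]; exists f => //=; move: h; congr (_ < _).
  by apply: eq_bigr => i _; rewrite predictorE tnth_mktuple.
Qed.

(** Only the first error pays for a union over [I]; for the second, the single statistic that
    matches the signs of b is enough. Each error pays [pi] once. *)
Lemma Risk_le (pi : R) : (P bad <= pi%:E)%E ->
  (Risk P X eps s A <=
    (2 * pi + (#|I|%:R + 1) * expR (- test_exponent))%:E)%E.
Proof.
move=> Ppi.
have e0 := eta0; have eh := eta2; have n00 := n0; have s00 := s0.
have mscore f b : measurable [set w | tau < score f w b].
  apply: measurable_fun_lt => //.
  apply: measurable_sum => i; apply: measurable_funM.
    have := measurableT_comp (measurable_predictor (v f) i) (measurable_Xtuple model).
    by apply: eq_measurable_fun => w _ /=; rewrite predictorE.
  have := measurableT_comp (measurable_predictor b i) (measurable_Xtuple model).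
  have [_ mE _] := model; move=> /(measurable_funD) /(_ (mE i)).
  by apply: eq_measurable_fun => w _ /=; rewrite predictorE [in RHS]mxE.
have mscores b : measurable (\big[setU/set0]_(f : I) [set w | tau < score f w b]).
  exact: measurable_bigsetU_fin.
have mtail b c t : measurable [set w | (energy b (XT w) <= c)%R /\ (t <= noise_form X eps b w)%R].
  rewrite (_ : mkset _ = [set w | energy b (XT w) <= c] `&` [set w | t <= noise_form X eps b w])//.
  apply: measurableI; rewrite -[X in measurable X]setTI; apply: measurable_fun_le => //.
    exact: (measurableT_comp (measurable_energy b) (measurable_Xtuple model)).
  exact: (measurable_noise_form model).
have e1 : n%:R * s%:R * A ^+ 2 / (8 * (1 + eta)) = tau ^+ 2 / (2 * C).
  rewrite /tau /C; field; rewrite !gt_eqF//; lra.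
have e2 : test_exponent = tau' ^+ 2 / (2 * C).
  rewrite /test_exponent /tau' /C; field; rewrite !gt_eqF//; lra.
(* Since [tau] is at least [tau'], the exponent of the second error is the smaller one and serves
   for both. *)
have e12 : test_exponent <= tau ^+ 2 / (2 * C).
  rewrite -e1 /test_exponent ler_wpM2r ?invr_ge0//; first by lra.
  rewrite ler_piMr// ?mulr_ge0// ?sqr_ge0//.
  by rewrite expr_le1//; lra.
apply: ge_ereal_inf; exists (RiskT P X eps T s A); first by exists T.
have -> : (2 * pi + (#|I|%:R + 1) * expR (- test_exponent))%:E =
  ((pi + #|I|%:R * expR (- test_exponent))%:E +
   (pi + expR (- test_exponent))%:E :> \bar R)%E.
  by rewrite -EFinD; congr EFin; ring.
apply: leeD.
- rewrite /Ebeta; under eq_integral do rewrite TE.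
  rewrite integral_indic// setIT.
  set D := \big[_/_]_(_ : I) _.
  pose S f := [set w | (energy (v f) (XT w) <= C)%R /\ (tau <= noise_form X eps (v f) w)%R].
  have DS : D `<=` bad `|` \big[setU/set0]_(f : I) S f.
    move=> w; rewrite /D -!bigcup_seq => -[f fI /= h].
    have [|good] := pselect (bad w); [by left|right].
    exists f => //; split; first exact: energy_good.
    apply/ltW; apply: lt_le_trans h _; rewrite le_eqVlt; apply/orP; left; apply/eqP.
    by apply: eq_bigr => i _; rewrite mulmx0 add0r.
  have mSf f : measurable (S f) by exact: mtail.
  have mS : measurable (\big[setU/set0]_(f : I) S f) by exact: measurable_bigsetU_fin.
  apply: (@le_trans _ _ (P (bad `|` \big[setU/set0]_(f : I) S f))).
    apply: le_measure => //; rewrite inE; first exact: mscores.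
    exact: measurableU measurable_bad mS.
  apply: (le_trans (measureU2 _ measurable_bad mS)).
  rewrite EFinD; apply: leeD => //; apply: measure_bigsetU_fin_le => // f.
  apply: le_trans (noise_form_tail model _ C0 _) _; first by rewrite /tau !mulr_ge0 ?invr_ge0 ?ler0n.
  by rewrite lee_fin ler_expR lerN2.
- apply: ge_ereal_sup => _ [b Xib <-].
  have [f bv] := v_cover Xib.
  have -> : Ebeta P X eps (fun z => 1 - T z) b =
      P (~` \big[setU/set0]_(f : I) [set w | tau < score f w b]).
    rewrite -[X in _ = P X]setIT -integral_indic//; last exact: measurableC.
    apply: eq_integral => w _; rewrite TE; congr EFin.
    by rewrite !indicE in_setC; case: (_ \in _); rewrite /= ?subrr ?subr0.
  (* A miss forces <Xv, eps> <= - tau'; negating v makes this an upper tail. *)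
  pose S := [set w | (energy (- v f) (XT w) <= C)%R /\ (tau' <= noise_form X eps (- v f) w)%R].
  have DS : (~` \big[setU/set0]_(f : I) [set w | tau < score f w b]) `<=` bad `|` S.
    move=> w Dw; have [|good] := pselect (bad w); [by left|right].
    have : score f w b <= tau.
      rewrite leNgt; apply/negP => h; apply: Dw.
      by rewrite -bigcup_seq; exists f => //=; rewrite mem_index_enum.
    have := signal_good good Xib bv.
    have -> : score f w b = \sum_(i < n) (X w *m v f) i 0 * (X w *m b) i 0 +
        noise_form X eps (v f) w.
      rewrite /score /noise_form -big_split/=; apply: eq_bigr => i _.
      by rewrite [(X w *m b + eps w) i 0]mxE mulrDr.
    move=> h1 h2; split.
      rewrite energyE; under eq_bigr do rewrite mulmxN mxE sqrrN.
      by rewrite -energyE; exact: energy_good.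
    have -> : noise_form X eps (- v f) w = - noise_form X eps (v f) w.
      rewrite /noise_form -sumrN; apply: eq_bigr => i _.
      by rewrite mulmxN mxE mulNr.
    move: h1 h2; rewrite /tau /tau'; lra.
  apply: (@le_trans _ _ (P (bad `|` S))).
    apply: le_measure => //; rewrite inE; first exact: measurableC.
    exact: measurableU measurable_bad (mtail _ _ _).
  apply: (le_trans (measureU2 _ measurable_bad (mtail _ _ _))).
  rewrite EFinD; apply: leeD => //.
  apply: le_trans (noise_form_tail model _ C0 _) _.
    by rewrite /tau' mulr_ge0 ?mulr_ge0//; lra.
  by rewrite lee_fin -e2.
Qed.

End upper_bound.

(** * The finite family of sign vectors indexing the test *)

Section sign_vectors.
Context {R : realType} (p s : nat).

(** Ordered lists of distinct positions with signs. Every vector arises s! times, which does no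
    harm: only the bound (2p)^s on their number matters. *)
Definition signed_support :=
  {f : {ffun 'I_s -> 'I_p * bool} | injectiveb (fun k => (f k).1)}.

Definition sign_vector (f : signed_support) : 'cV[R]_p :=
  \col_j \sum_(k < s) (j == (val f k).1)%:R * (-1) ^+ (val f k).2.

Lemma card_signed_support : (#|{: signed_support}| <= (p * 2) ^ s)%N.
Proof.
rewrite card_sig; apply: leq_trans (max_card _) _.
by rewrite card_ffun card_prod card_bool !card_ord.
Qed.

Lemma sign_vector_in (f : signed_support) k :
  sign_vector f (val f k).1 0 = (-1) ^+ (val f k).2.
Proof.
rewrite mxE (bigD1 k)//= eqxx mul1r big1 ?addr0// => l lk.
case: eqP => [kl|]; last by rewrite mul0r.
have /injectiveP inj := valP f.
by rewrite (inj _ _ kl) eqxx in lk.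
Qed.

Lemma sign_vector_out (f : signed_support) j :
  (forall k, j != (val f k).1) -> sign_vector f j 0 = 0.
Proof.
move=> jf; rewrite mxE big1// => k _.
by rewrite (negbTE (jf k)) mul0r.
Qed.

Lemma norm_sign_vector (f : signed_support) j :
  `|sign_vector f j 0| = \sum_(k < s) (j == (val f k).1)%:R.
Proof.
have [[k ->]|jf] := pselect (exists k, j = (val f k).1).
  rewrite sign_vector_in normrX normrN1 expr1n (bigD1 k)//= eqxx big1 ?addr0// => l lk.
  case: eqP => // kl; have /injectiveP inj := valP f.
  by rewrite (inj _ _ kl) eqxx in lk.
have {}jf k : j != (val f k).1 by apply/eqP => jk; apply: jf; exists k.
by rewrite sign_vector_out// normr0 big1// => k _; rewrite (negbTE (jf k)).
Qed.

Lemma sign_vector_sign (f : signed_support) j :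
  sign_vector f j 0 ^+ 2 = `|sign_vector f j 0|.
Proof.
have [[k ->]|jf] := pselect (exists k, j = (val f k).1).
  by rewrite sign_vector_in sqrr_sign normrX normrN1 expr1n.
have {}jf k : j != (val f k).1 by apply/eqP => jk; apply: jf; exists k.
by rewrite sign_vector_out// normr0 expr0n.
Qed.

Lemma sign_vector_size (f : signed_support) :
  \sum_(j < p) `|sign_vector f j 0| = s%:R.
Proof.
under eq_bigr do rewrite norm_sign_vector.
rewrite exchange_big/= -[in RHS](card_ord s) -sum1_card natr_sum.
apply: eq_bigr => k _; rewrite (bigD1 (val f k).1)//= eqxx big1 ?addr0// => j jk.
by rewrite (negbTE jk).
Qed.

Lemma sign_vector_cover (A : R) (b : 'cV[R]_p) : Xi s A b ->
  exists f, forall j, b j 0 * sign_vector f j 0 = `|b j 0|.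
Proof.
move=> [bs _]; set S := mem [set i : 'I_p | b i 0 != 0] in bs.
pose g (k : 'I_s) := enum_val (cast_ord (esym bs) k).
pose f0 : {ffun 'I_s -> 'I_p * bool} := [ffun k => (g k, b (g k) 0 < 0)].
have f0P : injectiveb (fun k => (f0 k).1).
  apply/injectiveP => k l; rewrite !ffunE/= => /enum_val_inj.
  exact: cast_ord_inj.
exists (exist _ f0 f0P) => j.
have [bj|bj] := eqVneq (b j 0) 0; first by rewrite bj mul0r normr0.
have jS : j \in S by rewrite inE.
pose k := cast_ord bs (enum_rank_in jS j).
have gk : g k = j by rewrite /g /k cast_ordK enum_rankK_in.
have := sign_vector_in (exist _ f0 f0P) k; rewrite /= ffunE/= gk => ->.
by rewrite [in RHS](numEsign (b j 0)) ?num_real// normrM normr_sign mul1r normr_id mulrC -normrEsign ?num_real.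
Qed.

End sign_vectors.

(** * Sub-Gaussian designs *)

Section exp_inequalities.
Context {R : realType}.

(** Everything comes from exp z (1 - z) <= 1: for z >= 0 use exp z <= 1 + z exp z twice, and for z <
    0 use (1 + z + z^2) (1 - z) = 1 - z^3 >= 1. *)
Lemma expR_le_quadratic (z : R) : expR z <= 1 + z + z ^+ 2 * expR `|z|.
Proof.
have [z0|z0] := leP 0 z.
  rewrite ger0_norm//.
  have h : (1 - z) * expR z <= 1.
    rewrite -[leRHS](expRxMexpNx_1 z) mulrC ler_wpM2l ?expR_ge0//.
    exact: expR_ge1Dx.
  nra.
have := expR_ge1Dx (- z) => h.
have e1 : 1 <= expR `|z| by rewrite -[leLHS]expR0 ler_expR.
have h1 : expR z * (1 - z) <= 1.
  by rewrite -[leRHS](expRxMexpNx_1 z) ler_wpM2l ?expR_ge0.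
have h2 : expR z <= 1 + z + z ^+ 2.
  rewrite -(ler_pM2r (_ : 0 < 1 - z)); last by lra.
  apply: (le_trans h1); nra.
have := sqr_ge0 z; nra.
Qed.

Lemma sqr_le_expR (y : R) : 0 <= y -> y ^+ 2 <= 16 * expR (y / 2).
Proof.
move=> y0; have -> : y / 2 = y / 4 + y / 4 by field.
rewrite expRD; have := expR_ge1Dx (y / 4); nra.
Qed.

(** The factor exp |y| is spent in two halves: one absorbs y^2 at the price of the constant 16, the
    other dominates exp |r y| because |r| <= 1/2. *)
Lemma expR_scale_le (r y : R) : `|r| <= 2^-1 ->
  expR (r * y) <= 1 + r * y + 16 * r ^+ 2 * expR `|y|.
Proof.
move=> r2; apply: (le_trans (expR_le_quadratic _)); rewrite lerD2l.
have h1 : expR `|r * y| <= expR (`|y| / 2).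
  by rewrite ler_expR normrM mulrC ler_wpM2l.
have h2 := sqr_le_expR (normr_ge0 y).
rewrite real_normK ?num_real// in h2.
have -> : `|y| = `|y| / 2 + `|y| / 2 by field.
rewrite expRD exprMn; set E := expR (_ / 2) in h1 h2 *.
have E0 : 0 <= E by exact: expR_ge0.
apply: (@le_trans _ _ (r ^+ 2 * (16 * E) * E)); last by rewrite le_eqVlt; apply/orP; left; apply/eqP; ring.
have h3 : r ^+ 2 * y ^+ 2 <= r ^+ 2 * (16 * E) by rewrite ler_wpM2l ?sqr_ge0.
have h4 : 0 <= r ^+ 2 * y ^+ 2 by rewrite mulr_ge0 ?sqr_ge0.
by apply: ler_pM => //; exact: expR_ge0.
Qed.

Lemma expR_half_sum (a b : R) : expR ((a + b) / 2) <= (expR a + expR b) / 2.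
Proof.
have -> : (a + b) / 2 = a / 2 + b / 2 by field.
have -> : expR a = expR (a / 2) ^+ 2 by rewrite expr2 -expRD; congr expR; field.
have -> : expR b = expR (b / 2) ^+ 2 by rewrite expr2 -expRD; congr expR; field.
rewrite expRD; have := sqr_ge0 (expR (a / 2) - expR (b / 2)); nra.
Qed.

End exp_inequalities.

Section subgaussian.
Context {R : realType} {d : measure_display} {Omega : measurableType d}.
Variable P : probability Omega R.

(* exp (Z^2 / (4 K)) is the average of exp (c g Z) over a standard Gaussian g,
   with c^2 = 1 / (2 K). *)
Lemma subgaussian_exp_sqr (Z : Omega -> R) (K : R) : 0 < K ->
  measurable_fun setT Z ->
  (forall t, (\int[P]_w (expR (t * Z w))%:E <= (expR (K * t ^+ 2 / 2))%:E)%E) ->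
  (\int[P]_w (expR (Z w ^+ 2 / (4 * K)))%:E <= (Num.sqrt 2)%:E)%E.
Proof.
move=> K0 mZ Zmgf.
pose c : R := (Num.sqrt (2 * K))^-1.
have c2 : c ^+ 2 = (2 * K)^-1 by rewrite exprVn sqr_sqrtr// mulr_ge0// ltW.
pose f (z : Omega * R) := (expR (c * z.2 * Z z.1))%:E.
have mf : measurable_fun setT f.
  apply/measurable_EFinP; apply: measurableT_comp => //; apply: measurable_funM.
    by apply: measurable_funM.
  exact: (measurableT_comp mZ measurable_fst).
have f0 z : (0 <= f z)%E by rewrite lee_fin expR_ge0.
have fE w : (\int[std_normal]_g f (w, g) = (expR (Z w ^+ 2 / (4 * K)))%:E)%E.
  rewrite ge0_integral_std_normal//; last exact: (measurableT_comp mf).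
  rewrite -[RHS]/((expR (Z w ^+ 2 / (4 * K)))%:E).
  transitivity (expR ((c * Z w) ^+ 2 / 2))%:E; last first.
    by congr (expR _)%:E; rewrite exprMn c2; field; rewrite gt_eqF.
  rewrite -normal_prob_mgf; apply: eq_integral => x _.
  by rewrite /f /= mulrAC.
under eq_integral do rewrite -fE.
rewrite (fubini_tonelli f)//.
apply: (@le_trans _ _ (\int[std_normal]_g (expR (g ^+ 2 / 4))%:E)%E).
  apply: ge0_le_integral => //.
  - by move=> g _; apply: integral_ge0.
  - exact: (measurable_fun_fubini_tonelli_G f).
  - apply/measurable_EFinP; apply: measurableT_comp => //.
    by apply: measurable_funM => //; exact: measurable_funX.
  - move=> g _; apply: (le_trans (Zmgf (c * g))); rewrite lee_fin ler_expR.
    by rewrite exprMn c2 le_eqVlt; apply/orP; left; apply/eqP; field; rewrite gt_eqF.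
rewrite ge0_integral_std_normal//; first by rewrite normal_prob_exp_sqr.
apply/measurable_EFinP; apply: measurableT_comp => //.
by apply: measurable_funM => //; exact: measurable_funX.
Qed.

(** The moment bound behind Bernstein's inequality: the linear term has mean zero, the quadratic one
    is controlled by a single exponential moment, and 1 + x <= exp x concludes. *)
Lemma centered_mgf_le (Y : Omega -> R) (M r : R) :
  P.-integrable setT (EFin \o Y) -> (\int[P]_w (Y w)%:E = 0)%E ->
  (\int[P]_w (expR `|Y w|)%:E <= M%:E)%E -> `|r| <= 2^-1 ->
  (\int[P]_w (expR (r * Y w))%:E <= (expR (16 * M * r ^+ 2))%:E)%E.
Proof.
move=> iY Y0 YM r2.
have mY : measurable_fun setT Y by apply/measurable_EFinP; exact: measurable_int iY.
have mE : measurable_fun setT (fun w => expR `|Y w|).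
  by apply: measurableT_comp => //; exact: measurableT_comp.
have iE : P.-integrable setT (fun w => (expR `|Y w|)%:E).
  apply/integrableP; split; first exact/measurable_EFinP.
  under eq_integral do rewrite /= ger0_norm ?expR_ge0//.
  exact: le_lt_trans YM (ltry _).
pose g w : R := r * Y w + 16 * r ^+ 2 * expR `|Y w|.
have irY : P.-integrable setT (fun w => (r * Y w)%:E).
  by apply: (integrableZl measurableT r iY).
have irE : P.-integrable setT (fun w => (16 * r ^+ 2 * expR `|Y w|)%:E).
  by apply: (integrableZl measurableT (16 * r ^+ 2) iE).
have i1 : P.-integrable setT (fun=> 1%:E : \bar R).
  exact: finite_measure_integrable_cst.
apply: (@le_trans _ _ (\int[P]_w ((1 + r * Y w) + 16 * r ^+ 2 * expR `|Y w|)%:E)%E).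
  apply: le_integral_EFin.
  - by apply: measurableT_comp => //; exact: measurable_funM.
  - by apply: measurable_funD; [apply: measurable_funD|]; rewrite //; exact: measurable_funM.
  - by move=> w; exact: expR_ge0.
  - by move=> w; exact: expR_scale_le.
under eq_integral do rewrite !EFinD.
rewrite integralD//; last exact: (integrableD _ i1 irY).
rewrite integralD// integral_cst_probability.
have -> : (\int[P]_w (r * Y w)%:E = 0)%E.
  by under eq_integral do rewrite EFinM; rewrite integralZl// Y0 mule0.
have r16 : 0 <= 16 * r ^+ 2 by rewrite mulr_ge0// sqr_ge0.
rewrite adde0 ge0_integralZl_fin//.
apply: (@le_trans _ _ (1%:E + (16 * r ^+ 2)%:E * M%:E)%E).
  by rewrite leeD2l// lee_wpmul2l// lee_fin.
rewrite -EFinM -EFinD lee_fin mulrAC.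
exact: expR_ge1Dx.
Qed.

End subgaussian.

Section subgaussian_design.
Context {R : realType} {d : measure_display} {Omega : measurableType d}.
Variables (n p : nat) (P : probability Omega R).
Variables (X : Omega -> 'M[R]_(n, p)) (eps : Omega -> 'cV[R]_n).
Hypothesis model : linear_model P X eps.
Variable sigma2 : R.
Hypothesis subg : SubG sigma2 P X.

Local Notation row i w := (row_tuple (X w) i).

Lemma measurable_row i : measurable_fun setT (fun w => row i w).
Proof.
apply: eq_measurable_fun (measurableT_comp (measurable_tnth i) (measurable_Xtuple model)).
by move=> w _ /=; rewrite tnth_mktuple.
Qed.

(** Row independence is stated for rectangles of events; identifying the joint law of the rows with
    [iid_prob nu n] extends it to products of functions. *)
Lemma integral_rows_prod_le (f : p.-tuple R -> R) (c : R) :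
  measurable_fun setT f -> (forall t, 0 <= f t) ->
  (forall i, (\int[P]_w (f (row i w))%:E <= c%:E)%E) ->
  (\int[P]_w (\prod_(i < n) f (row i w))%:E <= (c ^+ n)%:E)%E.
Proof.
move=> mf f0 fc.
(* The common law [nu] is read off from some row, so n = 0 is treated apart. *)
have [i0|n0] := pselect (exists i : 'I_n, true); last first.
  have n00 : n = 0%N.
    by case: (posnP n) => // n1; exfalso; apply: n0; exists (Ordinal n1).
  under eq_integral => w _.
    rewrite big1 => [|i]; last by exfalso; apply: n0; exists i.
    over.
  by rewrite integral_cst_probability n00 expr0.
case: i0 => i0 _.
pose X0 : {mfun Omega >-> p.-tuple R} :=
  HB.pack (fun w => row i0 w) (isMeasurableFun.Build _ _ _ _ _ (measurable_row i0)).
pose XT : {mfun Omega >-> n.-tuple (p.-tuple R)} :=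
  HB.pack (Xtuple X) (isMeasurableFun.Build _ _ _ _ _ (measurable_Xtuple model)).
pose nu := distribution P X0.
have [indep [same _]] := subg.
have mprod : measurable_fun setT (fun x : n.-tuple (p.-tuple R) => (\prod_(i < n) f (tnth x i))%:E).
  apply/measurable_EFinP; apply: measurable_prod => i _.
  by apply: (measurableT_comp mf); exact: measurable_tnth.
have prod0 (x : n.-tuple (p.-tuple R)) : (0 <= (\prod_(i < n) f (tnth x i))%:E)%E.
  by rewrite lee_fin prodr_ge0.
have -> : (\int[P]_w (\prod_(i < n) f (row i w))%:E =
    \int[distribution P XT]_x (\prod_(i < n) f (tnth x i))%:E)%E.
  rewrite ge0_integral_distribution//; apply: eq_integral => w _ /=.
  by congr EFin; apply: eq_bigr => i _; rewrite tnth_mktuple.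
have -> : (\int[distribution P XT]_x (\prod_(i < n) f (tnth x i))%:E =
    \int[iid_prob nu n]_x (\prod_(i < n) f (tnth x i))%:E)%E.
  apply: eq_measure_integral => A mA _.
  apply: (@tuple_measure_unique _ _ n (@measurable _ (p.-tuple R)) (fun=> setT)) => //.
  - by rewrite smallest_id//; exact: sigma_algebra_measurable.
  - exact: measurableI.
  - exact: bigcup_const.
  - move=> B mB; change (P (XT @^-1` box B) = iid_prob nu n (box B)).
    rewrite iid_prob_box//.
    transitivity (P [set w | forall i, B i (row i w)]).
      congr (P _); apply/seteqP; split => w /= h i; move: (h i);
        by rewrite tnth_mktuple.
    rewrite indep// -prodEFin; apply: eq_bigr => i _.
    rewrite fineK; first by rewrite (same _ _ i0).
    apply: fin_num_measure; rewrite -[X in measurable X]setTI.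
    exact: measurable_row.
  - by rewrite -ge0_fin_numE// fin_num_measure.
rewrite (@ge0_integral_iid_prod _ _ _ nu n (fun=> f))//.
have nuc : (\int[nu]_x (f x)%:E <= c%:E)%E.
  by rewrite ge0_integral_distribution//; [exact: fc|exact/measurable_EFinP].
have nu0 : (0 <= \int[nu]_x (f x)%:E)%E by apply: integral_ge0 => x _; rewrite lee_fin.
have fnu : (\int[nu]_x (f x)%:E \is a fin_num)%E.
  by rewrite ge0_fin_numE// (le_lt_trans nuc) ?ltry.
rewrite -(fineK fnu) prodEFin lee_fin prodr_const card_ord.
have I0 := fine_ge0 nu0.
have Ic : fine (\int[nu]_x (f x)%:E) <= c by rewrite -lee_fin fineK.
by apply: lerXn2r => //; rewrite nnegrE//; exact: le_trans Ic.
Qed.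

Section direction.
Variables (u : 'cV[R]_p) (j : 'I_p).
Hypothesis u1 : \sum_(k < p) u k 0 ^+ 2 = 1.

Let K : R := Num.max sigma2 1.
(** The scale at which squares of one-dimensional marginals have an exponential moment at most sqrt
    2. The maximum with 1 makes it positive and at most 1/4 for every [sigma2]. *)
Definition subg_rate : R := (4 * Num.max sigma2 1)^-1.
Local Notation theta := subg_rate.

Let K1 : 1 <= K. Proof. by rewrite le_max lexx orbT. Qed.
Let K0 : 0 < K. Proof. exact: lt_le_trans K1. Qed.

Lemma subg_rate_gt0 : 0 < theta.
Proof. by rewrite invr_gt0 mulr_gt0. Qed.

Lemma subg_rate_le : theta <= 4^-1.
Proof.
by rewrite lef_pV2 ?posrE ?mulr_gt0// ler_peMr.
Qed.

Definition row_dot (t : p.-tuple R) : R := \sum_(k < p) u k 0 * tnth t k.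

Lemma measurable_row_dot : measurable_fun setT row_dot.
Proof.
apply: measurable_sum => k; apply: measurable_funM => //.
exact: measurable_tnth.
Qed.

Lemma row_dotE i w : row_dot (row i w) = \sum_(k < p) u k 0 * X w i k.
Proof. by apply: eq_bigr => k _; rewrite tnth_mktuple. Qed.

Lemma row_dot_exp_sqr i :
  (\int[P]_w (expR (theta * row_dot (row i w) ^+ 2))%:E <= (Num.sqrt 2)%:E)%E.
Proof.
under eq_integral do rewrite mulrC.
apply: subgaussian_exp_sqr => //.
  exact: (measurableT_comp measurable_row_dot (measurable_row i)).
move=> t; have [_ [_ [_ [_ [+ _]]]]] := subg.
move=> /(_ i u u1 t) => h.
apply: (le_trans _ (le_trans h _)).
  by rewrite le_eqVlt; apply/orP; left; apply/eqP; apply: eq_integral => w _; rewrite row_dotE.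
by rewrite lee_fin ler_expR !ler_wpM2r ?sqr_ge0 ?invr_ge0// le_max lexx.
Qed.

End direction.

Local Notation theta := subg_rate.

Section gram_entry.
Variables (u : 'cV[R]_p) (j : 'I_p).
Hypothesis u1 : \sum_(k < p) u k 0 ^+ 2 = 1.

(** Contribution of one row to entry j of X^T X u - n u; isotropy makes it centred. *)
Definition gram_term (t : p.-tuple R) : R := row_dot u t * tnth t j - u j 0.

Lemma measurable_gram_term : measurable_fun setT gram_term.
Proof.
apply: measurable_funB => //; apply: measurable_funM.
  exact: measurable_row_dot.
exact: measurable_tnth.
Qed.

Lemma coord_exp_sqr i :
  (\int[P]_w (expR (theta * tnth (row i w) j ^+ 2))%:E <= (Num.sqrt 2)%:E)%E.
Proof.
have e1 : \sum_(k < p) (delta_mx j 0 : 'cV[R]_p) k 0 ^+ 2 = 1.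
  rewrite (bigD1 j)//= mxE !eqxx expr1n big1 ?addr0// => k kj.
  by rewrite mxE (negbTE kj) expr0n.
have := row_dot_exp_sqr e1 i.
apply: le_trans; rewrite le_eqVlt; apply/orP; left; apply/eqP.
apply: eq_integral => w _; congr (expR (_ * _ ^+ 2))%:E.
rewrite /row_dot (bigD1 j)//= mxE !eqxx mul1r big1 ?addr0// => k kj.
by rewrite mxE (negbTE kj) mul0r.
Qed.

Let u_le1 : `|u j 0| <= 1.
Proof.
rewrite -[leRHS]sqrtr1 -sqrtr_sqr ler_sqrt// -u1 (bigD1 j)//= lerDl.
by apply: sumr_ge0 => k _; exact: sqr_ge0.
Qed.

(** A product of two sub-Gaussian variables is sub-exponential, by |x y| <= (x^2 + y^2) / 2 and
    convexity of exp. The centring costs exp theta <= 4/3, so the mean is at most (2/3) (2 sqrt 2),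
    below 4. *)
Lemma gram_term_exp i :
  (\int[P]_w (expR `|theta * gram_term (row i w)|)%:E <= 4%:E)%E.
Proof.
have t0 := subg_rate_gt0; have t4 := subg_rate_le.
pose a w := expR (theta * row_dot u (row i w) ^+ 2).
pose b w := expR (theta * tnth (row i w) j ^+ 2).
have mU : measurable_fun setT (fun w => row_dot u (row i w)).
  exact: (measurableT_comp (measurable_row_dot u) (measurable_row i)).
have mW : measurable_fun setT (fun w => tnth (row i w) j).
  exact: (measurableT_comp (measurable_tnth j) (measurable_row i)).
have ma : measurable_fun setT a.
  by apply: measurableT_comp => //; apply: measurable_funM => //; exact: measurable_funX.
have mb : measurable_fun setT b.
  by apply: measurableT_comp => //; apply: measurable_funM => //; exact: measurable_funX.
have a0 w : 0 <= a w by exact: expR_ge0.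
have b0 w : 0 <= b w by exact: expR_ge0.
have mab : measurable_fun setT (fun w => a w + b w) by exact: measurable_funD.
have ab0 w : 0 <= a w + b w by exact: addr_ge0.
have k0 : 0 <= (2 / 3 : R) by [].
apply: (@le_trans _ _ (\int[P]_w (2 / 3 * (a w + b w))%:E)%E).
  apply: le_integral_EFin.
  - apply: measurableT_comp => //; apply: measurableT_comp => //.
    by apply: measurable_funM => //; exact: (measurableT_comp measurable_gram_term (measurable_row i)).
  - exact: measurable_funM.
  - by move=> w; exact: expR_ge0.
  move=> w.
  set x := row_dot u (row i w); set y := tnth (row i w) j.
  have et : expR theta <= 4 / 3.
    have h := expR_ge1Dx (- theta).
    rewrite -[leLHS]opprK -[theta]opprK opprK expRN -[leRHS]invrK lef_pV2 ?posrE ?invr_gt0 ?expR_gt0//.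
    by apply: le_trans h; rewrite invf_div; lra.
  apply: (@le_trans _ _ (expR (theta + (theta * x ^+ 2 + theta * y ^+ 2) / 2))).
    rewrite ler_expR normrM (ger0_norm (ltW t0)).
    have -> : theta + (theta * x ^+ 2 + theta * y ^+ 2) / 2 =
      theta * ((x ^+ 2 + y ^+ 2) / 2 + 1) by field.
    apply: ler_wpM2l; first exact: ltW.
    apply: (le_trans (ler_normB _ _)); apply: lerD => //.
    rewrite -/x -/y normrM -[x ^+ 2]real_normK ?num_real// -[y ^+ 2]real_normK ?num_real//.
    have := sqr_ge0 (`|x| - `|y|); nra.
  rewrite expRD; have -> : 2 / 3 * (a w + b w) = 4 / 3 * ((a w + b w) / 2) by field.
  by apply: ler_pM => //; rewrite ?expR_ge0//; exact: expR_half_sum.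
rewrite ge0_integralZl_fin// ge0_integralD_fin//.
apply: (@le_trans _ _ ((2 / 3)%:E * ((Num.sqrt 2)%:E + (Num.sqrt 2)%:E))%E).
  rewrite lee_wpmul2l//; apply: leeD; [exact: row_dot_exp_sqr|exact: coord_exp_sqr].
rewrite -EFinD -EFinM lee_fin.
have : Num.sqrt (2 : R) <= 2.
  by rewrite -[leRHS]ger0_norm// -sqrtr_sqr ler_sqrt//; lra.
lra.
Qed.

(** An identity between integrals yields integrability only for nonnegative integrands, that is for
    the diagonal of the isotropy relation; products of two entries are dominated by the sum of their
    squares. *)
Lemma integrable_entries i k : P.-integrable setT (fun w => (X w i k * X w i j)%:E).
Proof.
have [mX _ _] := model.
have [_ [_ [_ [second _]]]] := subg.
have isq l : P.-integrable setT (fun w => (X w i l * X w i l)%:E).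
  apply/integrableP; split.
    by apply/measurable_EFinP; exact: measurable_funM.
  under eq_integral do rewrite /= -expr2 ger0_norm ?sqr_ge0// expr2.
  by rewrite second ltry.
have := integrableD measurableT (isq k) (isq j).
apply: le_integrable => //.
  by apply/measurable_EFinP; exact: measurable_funM.
move=> w _; rewrite /= lee_fin normrM.
rewrite -!expr2 [leRHS]ger0_norm ?addr_ge0 ?sqr_ge0//.
rewrite -[X w i k ^+ 2]real_normK ?num_real// -[X w i j ^+ 2]real_normK ?num_real//.
have := sqr_ge0 (`|X w i k| - `|X w i j|).
have := sqr_ge0 (`|X w i k| + `|X w i j|); nra.
Qed.

Lemma gram_termE i w : gram_term (row i w) =
  \sum_(k < p) u k 0 * (X w i k * X w i j) - u j 0.
Proof.
rewrite /gram_term row_dotE tnth_mktuple mulr_suml; congr (_ - _).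
by apply: eq_bigr => k _; rewrite mulrA.
Qed.

Let iterm i (k : 'I_p) : P.-integrable setT (fun w => (u k 0 * (X w i k * X w i j))%:E).
Proof. exact: (integrableZl measurableT (u k 0) (integrable_entries i k)). Qed.

Let isum i : P.-integrable setT (fun w => (\sum_(k < p) u k 0 * (X w i k * X w i j))%:E).
Proof.
under eq_fun do rewrite -sumEFin.
by apply: integrable_sum => // k _; exact: iterm.
Qed.

Lemma integrable_gram_term i : P.-integrable setT (fun w => (gram_term (row i w))%:E).
Proof.
under eq_fun do rewrite gram_termE EFinB.
have ic : P.-integrable setT (fun=> (u j 0)%:E) by exact: finite_measure_integrable_cst.
exact: (integrableB measurableT (isum i) ic).
Qed.

Lemma integral_gram_term i : (\int[P]_w (gram_term (row i w))%:E = 0)%E.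
Proof.
under eq_integral do rewrite gram_termE EFinB.
have ic : P.-integrable setT (fun=> (u j 0)%:E) by exact: finite_measure_integrable_cst.
rewrite (integralB_EFin measurableT (isum i) ic).
rewrite integral_cst_probability.
under eq_integral do rewrite -sumEFin.
rewrite integral_sum//.
have [_ [_ [_ [second _]]]] := subg.
rewrite (eq_bigr (fun k => (u k 0 * (k == j)%:R)%:E)); last first.
  move=> k _; under eq_integral do rewrite EFinM.
  by rewrite integralZl// ?second -?EFinM//; exact: integrable_entries.
rewrite sumEFin (bigD1 j)//= eqxx mulr1 big1 ?addr0 ?subee// => k kj.
by rewrite (negbTE kj) mulr0.
Qed.

(** Bernstein's inequality over the rows; the sign [c] covers both tails. *)
Lemma gram_sum_tail (c t : R) : c ^+ 2 = 1 -> 0 <= t <= 1 ->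
  (P [set w | (n%:R * t <= c * \sum_(i < n) gram_term (row i w))%R] <=
   (expR (- (n%:R * (theta ^+ 2 * t ^+ 2 / 256))))%:E)%E.
Proof.
move=> c1 /andP[t0 t1].
have th0 := subg_rate_gt0; have th4 := subg_rate_le.
(* The minimiser of 64 r^2 - r theta t, where 64 = 16 * 4 combines [centered_mgf_le] with
   [gram_term_exp]. Its minimum is - theta^2 t^2 / 256. *)
pose r : R := theta * t / 128.
have r0 : 0 <= r by rewrite divr_ge0// mulr_ge0// ltW.
have cN : `|c| = 1.
  by apply/eqP; rewrite -sqrp_eq1// -normrX c1 normr1.
have rc : `|r * c| <= 2^-1.
  by rewrite normrM cN mulr1 ger0_norm// /r; nra.
pose f (x : p.-tuple R) := expR (r * c * (theta * gram_term x)).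
have mf : measurable_fun setT f.
  by apply: measurableT_comp => //; apply: measurable_funM => //;
    apply: measurable_funM => //; exact: measurable_gram_term.
have f0 x : 0 <= f x by exact: expR_ge0.
have fc i : (\int[P]_w (f (row i w))%:E <= (expR (64 * r ^+ 2))%:E)%E.
  have -> : 64 * r ^+ 2 = 16 * 4 * (r * c) ^+ 2 by rewrite [(r * c) ^+ 2]exprMn c1; ring.
  apply: (@centered_mgf_le _ _ _ P (fun w => theta * gram_term (row i w))) => //.
  - exact: (integrableZl measurableT theta (integrable_gram_term i)).
  - under eq_integral do rewrite EFinM.
    by rewrite integralZl// ?integral_gram_term ?mule0//; exact: integrable_gram_term.
  - exact: gram_term_exp.
have prodf := integral_rows_prod_le mf f0 fc.
set S := [set w | _].
have mG : measurable_fun setT (fun w => c * \sum_(i < n) gram_term (row i w)).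
  apply: measurable_funM => //; apply: measurable_sum => i.
  exact: (measurableT_comp measurable_gram_term (measurable_row i)).
have mS : measurable S.
  by rewrite -[S]setTI; exact: measurable_fun_le.
pose k : R := expR (- (r * theta * (n%:R * t))).
rewrite -[S]setIT -integral_indic//.
have mprod : measurable_fun setT (fun w => \prod_(i < n) f (row i w)).
  by apply: measurable_prod => i _; exact: (measurableT_comp mf (measurable_row i)).
apply: (@le_trans _ _ (\int[P]_w (k * \prod_(i < n) f (row i w))%:E)%E).
  apply: le_integral_EFin => //.
  - exact: measurable_funM.
  - move=> w; rewrite indicE; case: (boolP (w \in S)) => [|_]; last first.
      by rewrite mulr_ge0 ?expR_ge0 ?prodr_ge0.
    rewrite inE /S /= => h.
    rewrite -expR_sum -expRD -[leLHS]expR0 ler_expR.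
    have -> : \sum_(i < n) r * c * (theta * gram_term (row i w)) =
        r * theta * (c * \sum_(i < n) gram_term (row i w)).
      by rewrite !mulr_sumr; apply: eq_bigr => i _; ring.
    by rewrite addrC subr_ge0 ler_wpM2l// mulr_ge0// ltW.
rewrite ge0_integralZl_fin ?expR_ge0//; last by move=> w; exact: prodr_ge0.
apply: (@le_trans _ _ (k%:E * (expR (64 * r ^+ 2) ^+ n)%:E)%E).
  by rewrite lee_wpmul2l// lee_fin expR_ge0.
rewrite -EFinM lee_fin /k -expRM_natl -expRD ler_expR /r.
by rewrite le_eqVlt; apply/orP; left; apply/eqP; field.
Qed.

End gram_entry.

End subgaussian_design.

(** * What the two design classes provide *)

Section designs.
Context {R : realType} {d : measure_display} {Omega : measurableType d}.
Variables (n p : nat) (P : probability Omega R).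
Variables (X : Omega -> 'M[R]_(n, p)) (eps : Omega -> 'cV[R]_n).
Hypothesis model : linear_model P X eps.

Lemma energy_gram_col (b : 'cV[R]_p) w :
  energy b (Xtuple X w) = \sum_(j < p) b j 0 * gram_col X b j w.
Proof. by rewrite energyE -gram_colE; apply: eq_bigr => i _; rewrite expr2. Qed.

Lemma orth_gram_col (b : 'cV[R]_p) j w : Orth X ->
  gram_col X b j w = n%:R * b j 0.
Proof.
move=> /(_ w) oX.
transitivity (((X w)^T *m X w *m b) j 0).
  by rewrite -mulmxA [RHS]mxE; apply: eq_bigr => i _; rewrite [(X w)^T _ _]mxE.
by rewrite oX mul_scalar_mx mxE.
Qed.

Lemma orth_bad (eta : R) (I : finType) (v : I -> 'cV[R]_p) :
  Orth X -> 0 <= eta -> bad X eta v = set0.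
Proof.
move=> oX eta0; rewrite /bad big1// => -[f j] _ /=.
apply/seteqP; split => // w /=; rewrite orth_gram_col// subrr normr0 ltNge.
by rewrite mulr_ge0.
Qed.

Lemma orth_energy (b : 'cV[R]_p) : Orth X ->
  (\int[P]_w (energy b (Xtuple X w))%:E = (n%:R * \sum_(j < p) b j 0 ^+ 2)%:E)%E.
Proof.
move=> oX; rewrite -[RHS](integral_cst_probability P); apply: eq_integral => w _.
rewrite energy_gram_col mulr_sumr; congr EFin; apply: eq_bigr => j _.
by rewrite orth_gram_col//; ring.
Qed.

Section subg.
Variable sigma2 : R.
Hypothesis subg : SubG sigma2 P X.

Lemma gram_col_sum (b : 'cV[R]_p) j w :
  gram_col X b j w - n%:R * b j 0 =
  \sum_(i < n) gram_term b j (row_tuple (X w) i).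
Proof.
rewrite /gram_term sumrB sumr_const card_ord mulr_natl; congr (_ - _).
apply: eq_bigr => i _; rewrite tnth_mktuple mulrC row_dotE; congr (_ * _).
by rewrite mxE; apply: eq_bigr => k _; rewrite mulrC.
Qed.

(** The difference |Xb|^2 - n |b|^2 = <b, X^T X b - n b> is a weighted sum of centred terms
    [gram_term]. *)
Lemma subg_energy (b : 'cV[R]_p) :
  (\int[P]_w (energy b (Xtuple X w))%:E = (n%:R * \sum_(j < p) b j 0 ^+ 2)%:E)%E.
Proof.
have iY (j : 'I_p) (i : 'I_n) : P.-integrable setT
    (fun w => (b j 0 * gram_term b j (row_tuple (X w) i))%:E).
  exact: (integrableZl measurableT (b j 0) (integrable_gram_term model subg b j i)).
have iYs (j : 'I_p) : P.-integrable setT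
    (fun w => (\sum_(i < n) b j 0 * gram_term b j (row_tuple (X w) i))%:E).
  under eq_fun do rewrite -sumEFin.
  by apply: integrable_sum => // i _; exact: iY.
have iYss : P.-integrable setT (fun w =>
    (\sum_(j < p) \sum_(i < n) b j 0 * gram_term b j (row_tuple (X w) i))%:E).
  under eq_fun do rewrite -sumEFin.
  by apply: integrable_sum => // j _; exact: iYs.
have ic : P.-integrable setT (fun=> (n%:R * \sum_(j < p) b j 0 ^+ 2)%:E).
  exact: finite_measure_integrable_cst.
transitivity (\int[P]_w
  ((\sum_(j < p) \sum_(i < n) b j 0 * gram_term b j (row_tuple (X w) i))%:E +
   (n%:R * \sum_(j < p) b j 0 ^+ 2)%:E))%E.
  apply: eq_integral => w _; rewrite -EFinD; congr EFin.
  rewrite energy_gram_col [X in _ = _ + X]mulr_sumr -big_split/=; apply: eq_bigr => j _.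
  by rewrite -mulr_sumr -gram_col_sum; ring.
rewrite (integralD measurableT iYss ic) integral_cst_probability.
have -> : (\int[P]_w (\sum_(j < p) \sum_(i < n) b j 0 *
    gram_term b j (row_tuple (X w) i))%:E = 0)%E.
  under eq_integral do rewrite -sumEFin.
  rewrite integral_sum// big1// => j _.
  under eq_integral do rewrite -sumEFin.
  rewrite integral_sum// big1// => i _.
  under eq_integral do rewrite EFinM.
  rewrite integralZl// ?(integral_gram_term model subg) ?mule0//.
  exact: (integrable_gram_term model subg).
by rewrite add0e.
Qed.

(** A sign vector has norm sqrt s. Dividing by it turns the deviation eta n into n t with t = eta /
    sqrt s, so the exponent is of order n eta^2 / s; the factor 2 counts the two tails. *)
Lemma subg_bad (s : nat) (eta : R) : 0 < s%:R :> R -> 0 <= eta <= 1 ->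
  (P (bad X eta (@sign_vector R p s)) <=
   (#|{: signed_support p s * 'I_p}|%:R *
     (2 * expR (- (n%:R * (subg_rate sigma2 ^+ 2 * eta ^+ 2 / 256) / s%:R))))%:E)%E.
Proof.
move=> s0 /andP[eta0 eta1].
have sq0 : 0 < Num.sqrt (s%:R : R) by rewrite sqrtr_gt0.
have sq2 : Num.sqrt (s%:R : R) ^+ 2 = s%:R by rewrite sqr_sqrtr// ltW.
have sq1 : 1 <= Num.sqrt (s%:R : R).
  rewrite -[leLHS]sqrtr1 ler_sqrt//.
  by move: s0; rewrite ltr0n => ?; rewrite ler1n.
apply: measure_bigsetU_fin_le => -[f j] /=.
  apply: measurable_fun_lt => //; apply: measurableT_comp => //.
  by apply: measurable_funB => //; exact: (measurable_gram_col model).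
set v := sign_vector f.
pose u : 'cV[R]_p := (Num.sqrt s%:R)^-1 *: v.
have u1 : \sum_(k < p) u k 0 ^+ 2 = 1.
  transitivity ((s%:R)^-1 * \sum_(k < p) `|v k 0|).
    rewrite mulr_sumr; apply: eq_bigr => k _.
    by rewrite mxE exprMn exprVn sq2 /v sign_vector_sign.
  by rewrite /v sign_vector_size mulVf// gt_eqF.
pose t : R := eta / Num.sqrt s%:R.
have t01 : 0 <= t <= 1.
  have t0 : 0 <= t by rewrite /t divr_ge0// ltW.
  by rewrite t0 /t ler_pdivrMr// mul1r; exact: le_trans eta1 sq1.
have gE w : gram_col X v j w - n%:R * v j 0 =
    Num.sqrt s%:R * \sum_(i < n) gram_term u j (row_tuple (X w) i).
  rewrite -gram_col_sum.
  have -> : v = Num.sqrt s%:R *: u by rewrite /u scalerA divff ?scale1r// gt_eqF.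
  rewrite mulrBr [(_ *: u) j 0]mxE; congr (_ - _); last by ring.
  rewrite /gram_col mulr_sumr; apply: eq_bigr => i _.
  by rewrite -scalemxAr mxE; ring.
pose Sc (c : R) := [set w | n%:R * t <= c * \sum_(i < n) gram_term u j (row_tuple (X w) i)].
have mSc c : measurable (Sc c).
  rewrite -[Sc c]setTI; apply: measurable_fun_le => //; apply: measurable_funM => //.
  apply: measurable_sum => i.
  exact: (measurableT_comp (measurable_gram_term u j) (measurable_row model i)).
have sub : [set w | eta * n%:R < `|gram_col X v j w - n%:R * v j 0|] `<=`
    Sc 1 `|` Sc (-1).
  move=> w /=; rewrite gE normrM (gtr0_norm sq0) => h.
  have {}h : n%:R * t <= `|\sum_(i < n) gram_term u j (row_tuple (X w) i)|.
    rewrite /t mulrA ler_pdivrMr// mulrC [leRHS]mulrC; exact: ltW.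
  move: h; rewrite /Sc /= mul1r mulN1r ler_normr => /orP[]; [by left|by right].
have tail c : c ^+ 2 = 1 -> (P (Sc c) <=
    (expR (- (n%:R * (subg_rate sigma2 ^+ 2 * eta ^+ 2 / 256) / s%:R)))%:E)%E.
  move=> c1; apply: (le_trans (gram_sum_tail model subg j u1 c1 t01)).
  rewrite lee_fin ler_expR lerN2 /t expr_div_n sq2 le_eqVlt; apply/orP; left.
  by apply/eqP; field; rewrite gt_eqF.
apply: (@le_trans _ _ (P (Sc 1 `|` Sc (-1)))).
  apply: le_measure => //; rewrite inE; last exact: measurableU.
  apply: measurable_fun_lt => //; apply: measurableT_comp => //.
  by apply: measurable_funB => //; exact: (measurable_gram_col model).
apply: (le_trans (measureU2 _ (mSc _) (mSc _))).
rewrite mulr_natl mulr2n EFinD.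
by apply: leeD; apply: tail; rewrite ?sqrrN expr1n.
Qed.

End subg.

Lemma exists_Xi (s : nat) (A : R) : (s <= p)%N -> 0 < A ->
  exists2 b : 'cV[R]_p, Xi s A b & \sum_(j < p) b j 0 ^+ 2 = s%:R * A ^+ 2.
Proof.
move=> sp A0; pose b : 'cV[R]_p := \col_j (if (j < s)%N then A else 0).
have bE j : (b j 0 != 0) = (j < s)%N.
  by rewrite mxE; case: ifP => _; rewrite ?eqxx// gt_eqF.
exists b.
  split.
    rewrite -sum1_card (eq_bigl (fun j : 'I_p => (j < s)%N)); last first.
      by move=> j; rewrite -bE; apply/idP/idP; rewrite inE.
    by rewrite (big_ord_narrow sp) sum1_card card_ord.
  by move=> j; rewrite bE mxE => ->; exact: ler_norm.
rewrite (bigID (fun j : 'I_p => (j < s)%N))/= [X in _ + X]big1 ?addr0; last first.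
  by move=> j /negbTE js; rewrite mxE js expr0n.
rewrite (eq_bigr (fun=> A ^+ 2)); last by move=> j js; rewrite mxE js.
by rewrite (big_ord_narrow sp) sumr_const card_ord mulr_natl.
Qed.

(** Both designs enter through [energyP] and [badP] alone. The two bounds also make the risk finite,
    so that [fine] returns its true value. *)
Lemma Risk_bounds (s : nat) (A eta pi l : R) :
  l = n%:R * (s%:R * A ^+ 2) ->
  0 < n%:R :> R -> 0 < s%:R :> R -> (s <= p)%N -> 0 < A ->
  0 <= eta <= 2^-1 ->
  (forall b : 'cV[R]_p, (\int[P]_w (energy b (Xtuple X w))%:E =
    (n%:R * \sum_(j < p) b j 0 ^+ 2)%:E)%E) ->
  (P (bad X eta (@sign_vector R p s)) <= pi%:E)%E ->
  expR (- (l / 8 + 2 * Num.sqrt l)) <= fine (Risk P X eps s A) <=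
  2 * pi + (#|{: signed_support p s}|%:R + 1) *
    expR (- (l * (1 - 2 * eta) ^+ 2 / (8 * (1 + eta)))).
Proof.
move=> lE n0 s0 sp A0 /andP[eta0 eta2] energyP badP.
have l0 : 0 < l by rewrite lE !mulr_gt0// exprn_gt0.
have [b Xib b2] := exists_Xi sp A0.
have lo : ((expR (- (l / 8 + 2 * Num.sqrt l)))%:E <= Risk P X eps s A)%E.
  by apply: (Risk_ge model l0 Xib); rewrite energyP b2 lE.
have up := Risk_le model n0 s0 (ltW A0) eta0 eta2 (@sign_vector_sign R p s)
  (@sign_vector_size R p s) (@sign_vector_cover R p s A) badP.
have fR : (Risk P X eps s A \is a fin_num)%E.
  rewrite ge0_fin_numE; first exact: le_lt_trans up (ltry _).
  by apply: le_trans lo; rewrite lee_fin expR_ge0.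
rewrite -!lee_fin fineK// lo /=; apply: (le_trans up); rewrite lee_fin.
by rewrite /test_exponent lE mulrA.
Qed.

End designs.

(** * Asymptotics *)

Section asymptotics.
Context {R : realType}.

Lemma near_powR_ge (a C : R) : 0 < a ->
  \forall p \near \oo, C <= (p%:R : R) `^ a.
Proof.
move=> a0; near=> p.
have C0 : 0 <= Num.max C 0 by rewrite le_max lexx orbT.
apply: (@le_trans _ _ (Num.max C 0)); first by rewrite le_max lexx.
have -> : Num.max C 0 = (Num.max C 0 `^ a^-1) `^ a.
  by rewrite -powRrM mulVf ?gt_eqF// powRr1.
apply: ge0_ler_powR; rewrite ?nnegrE ?powR_ge0 ?(ltW a0)//.
by near: p; exact: nbhs_infty_ger.
Unshelve. all: by end_near. Qed.

(** Here [L] is Lambda, [l] is n s A^2, [q] is the relative loss from rounding s, and [M] is the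
    entropy of the union bounds. For the upper bound the budget e is split as follows: e / 2 for
    rounding and [eta] together, e / 4 for [M], e / 4 for adding two error terms. For the lower
    bound 2 sqrt l <= e L. *)
Lemma exponent_sandwich (e L l r eta pi N M q : R) :
  0 < e <= 8^-1 -> eta = 2 * e / 5 -> 0 < L ->
  L * (1 - q) <= l <= L -> 0 <= q <= 2 * e ->
  expR (- (l / 8 + 2 * Num.sqrt l)) <= r <=
    2 * pi + (N + 1) * expR (- (l * (1 - 2 * eta) ^+ 2 / (8 * (1 + eta)))) ->
  N + 1 <= expR M -> 2 * pi <= expR M * expR (- L) ->
  M <= e / 4 * L -> 1 <= e / 4 * L -> 4 <= e ^+ 2 * L ->
  `|- 8^-1 - ln r / L| <= e.
Proof.
move=> /andP[e0 e8] etaE L0 /andP[lL1 lL2] /andP[q0 q2] /andP[rlo rup] NM piM ML oneL fourL.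
have r0 : 0 < r by apply: lt_le_trans rlo; exact: expR_gt0.
have lo : - (L / 8 + e * L) <= ln r.
  have : - (l / 8 + 2 * Num.sqrt l) <= ln r.
    by rewrite -[leLHS]expRK ler_ln ?posrE ?expR_gt0.
  apply: le_trans; rewrite lerN2; apply: lerD; first lra.
  have sL : Num.sqrt l <= Num.sqrt L by rewrite ler_wsqrtr.
  have sL0 : 0 < Num.sqrt L by rewrite sqrtr_gt0.
  have sL2 : Num.sqrt L * Num.sqrt L = L by rewrite -expr2 sqr_sqrtr// ltW.
  apply: (@le_trans _ _ (2 * Num.sqrt L)); first lra.
  have : 2 <= e * Num.sqrt L.
    have eS : 0 <= e * Num.sqrt L by rewrite mulr_ge0 ?ltW.
    rewrite -(ler_pXn2r (_ : (0 < 2)%N)) ?nnegrE//.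
    by rewrite exprMn (sqr_sqrtr (ltW L0)); lra.
  nra.
have up : ln r <= - (L / 8 - e * L).
  have h : L * (8^-1 - e / 2) <= l * (1 - 2 * eta) ^+ 2 / (8 * (1 + eta)).
    rewrite ler_pdivlMr; last by lra.
    have l1 : L * (1 - 2 * e) <= l by nra.
    (* The value 2 e / 5 of [eta] is the one at which both sides agree to first order in e. *)
    have h1 : (1 - 2 * e) * (1 + eta) <= (1 - 2 * eta) ^+ 2.
      rewrite etaE; nra.
    apply: (@le_trans _ _ (l * ((1 - 2 * e) * (1 + eta)))).
      have -> : L * (8^-1 - e / 2) * (8 * (1 + eta)) = L * (1 - 4 * e) * (1 + eta) by field.
      rewrite mulrA ler_wpM2r//; first by lra.
      nra.
    by rewrite ler_wpM2l//; nra.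
  have b1 : (N + 1) * expR (- (l * (1 - 2 * eta) ^+ 2 / (8 * (1 + eta)))) <=
      expR (- (L * (8^-1 - 3 * e / 4))).
    apply: (@le_trans _ _ (expR M * expR (- (l * (1 - 2 * eta) ^+ 2 / (8 * (1 + eta)))))).
      by rewrite ler_wpM2r// expR_ge0.
    rewrite -expRD ler_expR; nra.
  have b2 : 2 * pi <= expR (- (L * (8^-1 - 3 * e / 4))).
    by apply: (le_trans piM); rewrite -expRD ler_expR; nra.
  have b3 : r <= expR (- (L / 8 - e * L)).
    apply: (le_trans rup).
    (* The two terms share a bound, and 2 <= exp 1 absorbs their sum. *)
    apply: (@le_trans _ _ (expR 1 * expR (- (L * (8^-1 - 3 * e / 4))))).
      have := expR_ge1Dx (1 : R).
      have := expR_ge0 (- (L * (8^-1 - 3 * e / 4))).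
      move: b1 b2; nra.
    by rewrite -expRD ler_expR; nra.
  by rewrite -[leRHS]expRK ler_ln ?posrE ?expR_gt0.
have -> : - 8^-1 - ln r / L = - ((L / 8 + ln r) / L) by field; rewrite gt_eqF.
rewrite normrN ler_norml ler_pdivlMr// ler_pdivrMr//.
by apply/andP; split; lra.
Qed.

(** Apply ln z <= z to z = (2 x)^k, and 2^k <= 2. *)
Lemma ln_le_powR (k x : R) : 0 < k <= 1 -> 1 <= x ->
  ln (2 * x) <= 2 / k * x `^ k.
Proof.
move=> /andP[k0 k1] x1.
have x0 : 0 < x by exact: lt_le_trans x1.
have : k * ln (2 * x) <= 2 * x `^ k.
  rewrite -ln_powR powRM//; last exact: ltW.
  have p0 : 0 < 2 `^ k * x `^ k by rewrite mulr_gt0// powR_gt0.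
  apply: (@le_trans _ _ (2 `^ k * x `^ k)).
    exact/ltW/ln_sublinear.
  rewrite ler_wpM2r ?powR_ge0//.
  by rewrite -[leRHS]powRr1// ler_powR//; lra.
by rewrite -mulrAC ler_pdivlMr// mulrC.
Qed.

(** The quantitative form of s log p = o(Lambda). Of the two factors x^k in [L], one dominates the
    logarithm and the other beats the constants. *)
Lemma exponential_cost_le (k e x y L M : R) :
  0 < k <= 1 -> 0 < e -> 1 <= x -> 1 <= y -> L = y * x `^ k * x `^ k ->
  (3 + 4 / k) * (4 / e) <= x `^ k -> M = 3 + (y + 1) * ln (2 * x) ->
  M <= e / 4 * L.
Proof.
move=> k01 e0 x1 y1 LE xk ->; have lnx := ln_le_powR k01 x1.
have /andP[k0 k1] := k01.
have x0 : 0 < x by exact: lt_le_trans x1.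
set z := x `^ k in LE xk lnx *.
have z1 : 1 <= z by rewrite /z -(powRr0 x) ler_powR// ltW.
have ln0 : 0 <= ln (2 * x) by rewrite ln_ge0//; lra.
have kk : 4 / k = 2 * (2 / k) by ring.
set c := 2 / k in lnx kk.
have c0 : 0 < c by rewrite divr_gt0.
have yz : 1 <= y * z by rewrite -[leLHS]mulr1 ler_pM.
apply: (@le_trans _ _ ((3 + 4 / k) * (y * z))).
  rewrite kk; apply: (@le_trans _ _ (3 + 2 * y * ln (2 * x))); first nra.
  have : y * ln (2 * x) <= y * (c * z) by rewrite ler_wpM2l//; lra.
  nra.
rewrite LE; have -> : e / 4 * (y * z * z) = (e / 4 * z) * (y * z) by ring.
rewrite ler_wpM2r//; first by lra.
move: xk; rewrite mulrA ler_pdivrMr// => xk; lra.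
Qed.

End asymptotics.

(** Origin of [M]: (2p)^s sign vectors, a further factor 2p for the choice of an entry of X^T X v,
    and exp 3 >= 4 for two errors times two tails. *)
Lemma signed_support_le_expR {R : realType} (p s : nat) (x y M : R) :
  x = p%:R -> 1 <= x -> s%:R <= y -> M = 3 + (y + 1) * ln (2 * x) ->
  4 * (#|{: signed_support p s}|%:R * x) <= expR M /\
  #|{: signed_support p s}|%:R + 1 <= expR M.
Proof.
move=> xE x1 sy ->.
have x0 : 0 < 2 * x by lra.
have ln0 : 0 <= ln (2 * x) by rewrite ln_ge0//; lra.
set N : R := #|_|%:R.
have N0 : 0 <= N by exact: ler0n.
set W := expR (y * ln (2 * x)).
have NW : N <= W.
  apply: (@le_trans _ _ ((2 * x) ^+ s)).
    rewrite /N xE; have := card_signed_support p s.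
    by rewrite -(ler_nat R) natrX natrM mulrC.
  rewrite /W -[X in X ^+ s](lnK x0) -expRM_natl ler_expR.
  by rewrite ler_wpM2r.
have W1 : 1 <= W.
  by rewrite -[leLHS]expR0 ler_expR mulr_ge0// (le_trans _ sy).
have ->: expR (3 + (y + 1) * ln (2 * x)) = expR 3 * (W * (2 * x)).
  by rewrite /W -[X in W * X]lnK ?posrE// -!expRD; congr expR; ring.
have e3 : 4 <= expR (3 : R) by have := expR_ge1Dx (3 : R); lra.
have Nx : N * x <= W * (2 * x) by nra.
have Wx : 1 <= W * (2 * x) by nra.
split; first by apply: ler_pM => //; nra.
have : 4 * (W * (2 * x)) <= expR 3 * (W * (2 * x)) by rewrite ler_wpM2r//; lra.
nra.
Qed.

(** * The estimate at a fixed dimension p *)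

Section fixed_dimension.
Context {R : realType} {d : measure_display} {Omega : measurableType d}.
Variables (n p : nat) (P : probability Omega R).
Variables (X : Omega -> 'M[R]_(n, p)) (eps : Omega -> 'cV[R]_n).
Hypothesis model : linear_model P X eps.

(** The growth of n enters through the premise x^2 <= n c eta^2. As s <= x and L <= x, it makes the
    Bernstein exponent at least [L], so a bad design costs exp (- L) up to entropy, negligible next
    to exp (- L / 8). *)
Lemma log_Risk_close (alpha kappa e c : R) (x y z L : R) :
  0 < alpha < 1 -> 0 < kappa <= 2^-1 -> 1 - alpha + kappa <= 1 ->
  0 < e <= 8^-1 ->
  x = p%:R -> y = x `^ (1 - alpha) -> z = x `^ kappa -> L = x `^ (1 - alpha + kappa) ->
  1 <= x -> 0 < n%:R :> R ->
  (3 + 4 / (kappa / 2)) * (4 / e) <= x `^ (kappa / 2) ->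
  (2 * e)^-1 <= y -> 4 / e ^+ 2 <= L -> 4 / e <= L ->
  (forall b : 'cV[R]_p, (\int[P]_w (energy b (Xtuple X w))%:E =
    (n%:R * \sum_(j < p) b j 0 ^+ 2)%:E)%E) ->
  (forall s : nat, 0 < s%:R :> R ->
    (P (bad X (2 * e / 5) (@sign_vector R p s)) <=
     (#|{: signed_support p s * 'I_p}|%:R *
       (2 * expR (- (n%:R * (c * (2 * e / 5) ^+ 2) / s%:R))))%:E)%E) ->
  x ^+ 2 <= n%:R * (c * (2 * e / 5) ^+ 2) ->
  `|- 8^-1 - ln (fine (Risk P X eps (Num.truncn y) (Num.sqrt (z / n%:R)))) / L| <= e.
Proof.
move=> /andP[a0 a1] /andP[k0 k1] ak /andP[e0 e8] xE yE zE LE x1 n0 xk ey eL eL' energyP badP nbig.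
have x0 : 0 < x by exact: lt_le_trans x1.
set s := Num.truncn y.
have y1 : 1 <= y by rewrite yE -[leLHS](powRr0 x) ler_powR//; lra.
have yx : y <= x by rewrite yE -[leRHS](powRr1 (ltW x0)) ler_powR//; lra.
have z0 : 0 < z by rewrite zE powR_gt0.
have Lyz : L = y * z by rewrite LE yE zE powRD// (gt_eqF x0) implybT.
have Lx : L <= x by rewrite LE -[leRHS](powRr1 (ltW x0)) ler_powR.
have L0 : 0 < L by rewrite LE powR_gt0.
have /andP[sy ys] : s%:R <= y < s.+1%:R by apply: truncn_itv; lra.
have s1 : 1 <= s%:R :> R.
  by rewrite ler1n /s truncn_gt0.
have s0 : 0 < s%:R :> R by exact: lt_le_trans s1.
have sp : (s <= p)%N by rewrite -(ler_nat R) -xE (le_trans sy).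
pose M : R := 3 + (y + 1) * ln (2 * x).
have [NM1 NM2] := signed_support_le_expR xE x1 sy (erefl M).
set N : R := #|_|%:R in NM1 NM2.
pose pi : R := N * x * (2 * expR (- L)).
pose l : R := n%:R * (s%:R * Num.sqrt (z / n%:R) ^+ 2).
have zn0 : 0 < z / n%:R by rewrite divr_gt0.
have lsz : l = s%:R * z.
  by rewrite /l (sqr_sqrtr (ltW zn0)); field; rewrite gt_eqF.
have bpi : (P (bad X (2 * e / 5) (@sign_vector R p s)) <= pi%:E)%E.
  apply: (le_trans (badP s s0)); rewrite lee_fin card_prod card_ord natrM -xE /pi.
  apply: ler_wpM2l; first by rewrite mulr_ge0// ltW.
  rewrite ler_wpM2l// ler_expR lerN2.
  rewrite ler_pdivlMr//; apply: le_trans nbig; rewrite expr2.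
  by apply: ler_pM => //; [exact: ltW|exact: le_trans sy yx].
have eta01 : 0 <= 2 * e / 5 <= 2^-1 by apply/andP; split; lra.
have bounds := Risk_bounds model (erefl l) n0 s0 sp (_ : 0 < Num.sqrt (z / n%:R))
  eta01 energyP bpi.
have e2 : 0 < e ^+ 2 by rewrite exprn_gt0.
(* Rounding loses at most one unit, s >= y - 1 = y (1 - 1 / y), whence q = 1 / y. *)
apply: (@exponent_sandwich R e L l _ (2 * e / 5) pi N M y^-1) => //.
- by rewrite e0.
- rewrite lsz Lyz; apply/andP; split.
    have -> : y * z * (1 - y^-1) = (y - 1) * z by field; rewrite gt_eqF//; lra.
    apply: ler_wpM2r; first exact: ltW.
    by move: ys; rewrite -natr1; lra.
  by apply: ler_wpM2r => //; exact: ltW.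
- rewrite invr_ge0 (le_trans _ y1)//= -[leRHS]invrK lef_pV2 ?posrE ?invr_gt0//; lra.
- by apply: bounds; rewrite sqrtr_gt0.
- have -> : 2 * pi = 4 * (N * x) * expR (- L) by rewrite /pi; ring.
  by rewrite ler_wpM2r// expR_ge0.
- apply: (@exponential_cost_le _ (kappa / 2) e x y L) => //.
  + by apply/andP; split; lra.
  + rewrite Lyz zE -mulrA -powRD; last by rewrite (gt_eqF x0) implybT.
    by rewrite -splitr.
- by move: eL'; rewrite ler_pdivrMr//; lra.
- by move: eL; rewrite ler_pdivrMr// mulrC.
Qed.

End fixed_dimension.

Theorem mainTheorem4 (R : realType) (alpha delta sigma2 : R)
  (halpha : 0 < alpha <= 2^-1)
  (hdelta : 0 < delta < 2^-1)
  (had : 0 < alpha - 2^-1 + delta)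
  (n : nat -> nat)
  (d : nat -> measure_display) (Omega : forall p : nat, measurableType (d p))
  (P : forall p : nat, probability (Omega p) R)
  (X : forall p : nat, Omega p -> 'M[R]_(n p, p))
  (eps : forall p : nat, Omega p -> 'cV[R]_(n p))
  (hmodel : forall p : nat, linear_model (P p) (X p) (eps p))
  (hdesign :
     ((forall p : nat, SubG sigma2 (P p) (X p)) /\
      ((fun p : nat => (n p)%:R / (p%:R) ^+ 2 : R) @ \oo --> +oo))
     \/
     ((forall p : nat, Orth (X p)) /\ (forall p : nat, (p <= n p)%N))) :
  let s := fun p : nat => Num.truncn ((p%:R : R) `^ (1 - alpha)) in
  let A := fun p : nat =>
             Num.sqrt ((p%:R : R) `^ (alpha - 2^-1 + delta) / (n p)%:R) in
  (fun p : nat =>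
     ln (fine (Risk (P p) (X p) (eps p) (s p) (A p)))
       / (p%:R : R) `^ (2^-1 + delta))
    @ \oo --> - (8%:R : R)^-1.
Proof.
move=> s A; apply/cvgrPdist_le => e0 e0_gt0.
(* The error budget of [exponent_sandwich] works for e <= 1/8 only. *)
pose e : R := Num.min (e0 : R) 8^-1.
have e_gt0 : 0 < e by rewrite /e lt_min e0_gt0 /=; lra.
have e8 : 0 < e <= 8^-1 by rewrite e_gt0 ge_min lexx orbT.
have ee0 : e <= e0 by rewrite ge_min lexx.
have [a0 a2] := andP halpha; have [d0 d2] := andP hdelta.
pose kappa := alpha - 2^-1 + delta.
have k0 : 0 < kappa by [].
(* Here n A^2 is p^kappa and s is p^(1 - alpha) up to rounding, so the normalisation is their
   product. *)
have LE : 2^-1 + delta = 1 - alpha + kappa by rewrite /kappa; lra.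
have a01 : 0 < alpha < 1 by apply/andP; split; lra.
have kk : 0 < kappa <= 2^-1 by apply/andP; split; rewrite // /kappa; lra.
have ak : 1 - alpha + kappa <= 1 by rewrite -LE; lra.
have k20 : 0 < kappa / 2 by rewrite divr_gt0.
have a10 : 0 < 1 - alpha by lra.
have ak0 : 0 < 1 - alpha + kappa by lra.
pose eta := 2 * e / 5.
have eta0 : 0 < eta by rewrite /eta; lra.
case: hdesign => -[design nlarge].
- pose c := subg_rate sigma2 ^+ 2 / 256.
  have c0 : 0 < c by rewrite divr_gt0// exprn_gt0// subg_rate_gt0.
  have ce0 : 0 < c * eta ^+ 2 by rewrite mulr_gt0// exprn_gt0.
  near=> p.
  have x1 : 1 <= (p%:R : R) by near: p; exact: nbhs_infty_ger.
  have x0 : 0 < (p%:R : R) by exact: lt_le_trans x1.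
  have nbig : (p%:R : R) ^+ 2 <= (n p)%:R * (c * eta ^+ 2).
    have : (c * eta ^+ 2)^-1 <= (n p)%:R / p%:R ^+ 2.
      by near: p; exact: (cvgryPge _).1.
    by rewrite ler_pdivlMr ?exprn_gt0// mulrC ler_pdivrMr.
  have n0 : 0 < (n p)%:R :> R.
    rewrite -(pmulr_lgt0 _ ce0) (lt_le_trans _ nbig)// exprn_gt0//.
  apply: le_trans ee0; rewrite LE.
  apply: (log_Risk_close (hmodel p) (c := c) a01 kk ak e8 (x := p%:R)) => //.
  + by near: p; exact: near_powR_ge.
  + by near: p; exact: near_powR_ge.
  + by near: p; exact: near_powR_ge.
  + by near: p; exact: near_powR_ge.
  + exact: subg_energy (hmodel p) _ (design p).
  + move=> t t0; apply: (le_trans (subg_bad (hmodel p) (design p) t0 _)).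
      by apply/andP; split; have := andP e8 => -[]; lra.
    by rewrite lee_fin /c (mulrAC _ _ 256^-1).
- near=> p.
  have x1 : 1 <= (p%:R : R) by near: p; exact: nbhs_infty_ger.
  have x0 : 0 < (p%:R : R) by exact: lt_le_trans x1.
  have n0 : 0 < (n p)%:R :> R.
    by rewrite (lt_le_trans x0)// ler_nat.
  apply: le_trans ee0; rewrite LE.
  (* The bad event is empty here, so any rate [c] is admissible; this one reduces the growth premise
     to p^2 <= n p^2. *)
  apply: (log_Risk_close (hmodel p) (c := p%:R ^+ 2 / eta ^+ 2) a01 kk ak e8 (x := p%:R)) => //.
  + by near: p; exact: near_powR_ge.
  + by near: p; exact: near_powR_ge.
  + by near: p; exact: near_powR_ge.
  + by near: p; exact: near_powR_ge.
  + by move=> b; exact: orth_energy.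
  + move=> t t0; rewrite (orth_bad _ (design p) (ltW eta0 : 0 <= 2 * e / 5)) measure0.
    by rewrite lee_fin !mulr_ge0 ?ler0n ?expR_ge0.
  + rewrite divfK ?gt_eqF ?exprn_gt0// ler_peMl ?sqr_ge0//.
    by rewrite (le_trans x1)// ler_nat.
Unshelve. all: by end_near. Qed.
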